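(* Let $z_0\in\mathbb{C}$ and let $p$ be a complex-valued function that is holomorphic and non-constant near $z_0$. If $p(z_0)=0$, then $C_a(p,z_0)=[0,2\pi)$. If $p(z_0)\neq 0$, let $k:=\min\{\ell\geq 1 : p^{(\ell)}(z_0)\neq 0\}$; then $C_a(p,z_0)$ and $C_d(p,z_0)$ partition the unit circle into alternating sectors of angle $\frac{\pi}{k}$. Specifically, if $re^{i\alpha}$ is the polar form of $\overline{p(z_0)}\,p^{(k)}(z_0)$, then $\theta$ is an argument of ascent of $p$ at $z_0$ if $$\frac{-2\alpha-\pi}{2k}<\theta<\frac{-2\alpha+\pi}{2k}\quad\left(\text{mod } \frac{2\pi}{k}\right),$$ i.e. if $\theta$ is congruent modulo $\frac{2\pi}{k}$ to a real number in this open interval. The interiors of the remaining sectors consist of arguments of descent of $p$ at $z_0$. A boundary point between two sectors is either an argument of ascent or an argument of descent.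
   Context: For a holomorphic function $p$ near $z_0\in\mathbb{C}$, an angle $\theta\in[0,2\pi)$ is an argument of ascent of $p$ at $z_0$ if there exists $t^*>0$ such that $|p(z_0+te^{i\theta})|>|p(z_0)|$ for all $t\in(0,t^* )$, and an argument of descent of $p$ at $z_0$ if there exists $t^*>0$ such that $|p(z_0+te^{i\theta})|<|p(z_0)|$ for all $t\in(0,t^* )$. The cone of ascent $C_a(p,z_0)$ is the set of arguments of ascent in $[0,2\pi)$, and the cone of descent $C_d(p,z_0)$ is the set of arguments of descent in $[0,2\pi)$. Angles in $[0,2\pi)$ (taken modulo $2\pi$) are identified with points $e^{i\theta}$ of the unit circle.
   Formalization: A boundary point is shown to be of ascent or descent only if |p| is not constant on an initial piece of its ray, so the cones cover the circle up to such boundary points; unrestricted, the claim fails for p=exp, z_0=0, θ=π/2. *)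

(* Defs.v *)
(* Library world: Stdlib reals with Coquelicot. *)
From Stdlib Require Import Reals Lra Lia ZArith Arith.
From Coquelicot Require Import Coquelicot.
Open Scope R_scope.

(* The point e^{i theta} of the unit circle. *)
Definition cis (theta : R) : C := (cos theta, sin theta).

(* [ex_derive] is taken over the field C, i.e. it is complex
   differentiability. *)
Definition holomorphic_near (p : C -> C) (z0 : C) : Prop :=
  locally z0 (fun z => @ex_derive C_AbsRing C_NormedModule p z).

Definition constant_near (p : C -> C) (z0 : C) : Prop :=
  locally z0 (fun z => p z = p z0).

(* Coquelicot's [C_derive] is a total operator which agrees with the complex
   derivative wherever the latter exists; its values elsewhere are
   irrelevant for the germ of a holomorphic function. *)
Definition C_derive_n (p : C -> C) (n : nat) : C -> C := Nat.iter n C_derive p.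

(* k = min { l >= 1 : p^(l)(z0) <> 0 }. *)
Definition first_nonzero_derivative (p : C -> C) (z0 : C) (k : nat) : Prop :=
  (1 <= k)%nat /\ C_derive_n p k z0 <> RtoC 0 /\
  (forall l : nat, (1 <= l < k)%nat -> C_derive_n p l z0 = RtoC 0).

(* The angles in [0, 2 pi), standing for the points of the unit circle. *)
Definition circle_angle (theta : R) : Prop := 0 <= theta < 2 * PI.

Definition cone_of_ascent (p : C -> C) (z0 : C) (theta : R) : Prop :=
  circle_angle theta /\
  exists tstar : R, 0 < tstar /\
    forall t : R, 0 < t < tstar ->
      Cmod (p (z0 + RtoC t * cis theta)%C) > Cmod (p z0).

Definition cone_of_descent (p : C -> C) (z0 : C) (theta : R) : Prop :=
  circle_angle theta /\
  exists tstar : R, 0 < tstar /\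
    forall t : R, 0 < t < tstar ->
      Cmod (p (z0 + RtoC t * cis theta)%C) < Cmod (p z0).

(* |p| is constant along an initial piece of the ray of angle theta. This does
   happen for nonconstant holomorphic p, always in a boundary direction: for
   p = exp and z0 = 0 it holds at theta = pi/2, which is then neither an
   argument of ascent nor an argument of descent. *)
Definition level_ray (p : C -> C) (z0 : C) (theta : R) : Prop :=
  exists tstar : R, 0 < tstar /\
    forall t : R, 0 < t < tstar ->
      Cmod (p (z0 + RtoC t * cis theta)%C) = Cmod (p z0).

Definition congruent_mod (m x y : R) : Prop := exists n : Z, x = y + IZR n * m.

(* The 2k equally spaced division angles of the circle, pi/k apart; sector j
   lies between the division angles j and j + 1, so that sector 0 is
   ((-2 alpha - pi)/(2k), (-2 alpha + pi)/(2k)). *)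
Definition division_angle (k : nat) (alpha : R) (j : nat) : R :=
  (- 2 * alpha + (2 * INR j - 1) * PI) / (2 * INR k).

Definition open_sector (k : nat) (alpha : R) (j : nat) (theta : R) : Prop :=
  circle_angle theta /\
  exists phi : R,
    division_angle k alpha j < phi < division_angle k alpha (S j) /\
    congruent_mod (2 * PI) theta phi.

Definition boundary_point (k : nat) (alpha : R) (j : nat) (theta : R) : Prop :=
  circle_angle theta /\ congruent_mod (2 * PI) theta (division_angle k alpha j).

(* The 2k open sectors and the 2k boundary points decompose the circle. *)
Definition sectors_decompose_circle (k : nat) (alpha : R) : Prop :=
  (forall theta : R, circle_angle theta ->
     exists j : nat, (j < 2 * k)%nat /\
       (open_sector k alpha j theta \/ boundary_point k alpha j theta)) /\
  (forall (i j : nat) (theta : R), (i < 2 * k)%nat -> (j < 2 * k)%nat ->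
     (open_sector k alpha i theta -> open_sector k alpha j theta -> i = j) /\
     (boundary_point k alpha i theta -> boundary_point k alpha j theta -> i = j) /\
     ~ (open_sector k alpha i theta /\ boundary_point k alpha j theta)).

(* Main.v *)
Require Import Defs.
From Stdlib Require Import Reals ZArith Arith Lra Lia.
From Coquelicot Require Import Coquelicot.
Open Scope R_scope.

(** Near [z0] a nonconstant holomorphic [p] is
    [p z0 + c (z - z0)^k + O((z - z0)^(k+1))], where [k >= 1] is the order of
    the first nonvanishing derivative and [c = p^(k)(z0) / k!]
    ([holomorphic_leading_term]).  If [p z0 = 0], then [|p|] is positive on
    every short ray.  Otherwise, with [r e^(i alpha)] the polar form of
    [conj (p z0) p^(k)(z0)], on the ray of angle [theta]
      [|p|^2 - |p z0|^2 = 2 (r / k!) cos (alpha + k theta) t^k + O(t^(k+1))]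
    ([modulus_leading_term]), so that the sign of [cos (alpha + k theta)]
    decides between ascent and descent.  This sign alternates on the [2 k]
    sectors, which are the unit intervals of the coordinate
    [(k theta + alpha) / pi + 1/2] taken modulo [2 k].

    On a division ray the cosine vanishes and the leading term of [p] decides
    nothing.  There [|p|^2] is the restriction to real [t] of the holomorphic
    function [p(z0 + z e^(i theta)) * conj (p(z0 + conj z e^(i theta)))]
    of [z]; applied to this function, the leading term theorem leaves only a
    level ray, ascent or descent ([ray_trichotomy]).

    Since holomorphy means here mere complex differentiability at each point,
    the leading term theorem needs the whole way from Goursat to Taylor.
    Goursat's theorem for rectangles is proved by bisection.  Composing with
    the exponential turns annuli into rectangles, so circle integrals do not
    depend on the radius, which is the mean value property; applied to
    [z (f z - f w) / (z - w)] it gives Cauchy's formula on a circle.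
    Differentiating the Cauchy kernel under the integral sign and expanding it
    as a finite geometric sum give the derivatives of every order and a Taylor
    formula whose remainders are bounded geometrically. *)

(** * Complex differentiability in terms of the modulus *)

Lemma locally_C_eps (z : C) (P : C -> Prop) :
  locally z P <->
  exists d : R, 0 < d /\ forall w : C, Cmod (w - z) < d -> P w.
Proof.
  refine (iff_trans (locally_C z P) _).
  split.
  - intros [d Hd]. exists d. split; [apply cond_pos | exact Hd].
  - intros [d [d0 Hd]]. exists (mkposreal d d0). exact Hd.
Qed.

Lemma continuous_C_eps {T : UniformSpace} (f : T -> C) (x : T) :
  continuous f x <->
  forall eps : R, 0 < eps -> locally x (fun y => Cmod (f y - f x) < eps).
Proof.
  split.
  - intros Hf eps He.
    apply (Hf (fun w => Cmod (w - f x) < eps)).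
    apply locally_C_eps. exists eps. split; auto.
  - intros Hf P HP. apply locally_C_eps in HP. destruct HP as [d [d0 Hd]].
    exact (filter_imp _ _ (fun y Hy => Hd (f y) Hy) (Hf d d0)).
Qed.

Lemma is_derive_C_eps (f : C -> C) (z l : C) :
  is_derive f z l <->
  forall eps : R, 0 < eps -> exists d : R, 0 < d /\
    forall w : C, Cmod (w - z) < d ->
      Cmod (f w - f z - l * (w - z)) <= eps * Cmod (w - z).
Proof.
  split.
  - intros [_ Hf] eps He.
    specialize (Hf z (fun P H => H) (mkposreal eps He)).
    apply (proj2 (locally_C z _)), locally_C_eps in Hf.
    destruct Hf as [d [d0 Hd]]. exists d. split; [exact d0|].
    intros w Hw. rewrite (Cmult_comm l). exact (Hd w Hw).
  - intros Hf. split; [apply is_linear_scal_l|].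
    intros x Hx.
    assert (E : z = x)
      by exact (@is_filter_lim_locally_unique C_AbsRing
                  (AbsRing_NormedModule C_AbsRing) z x Hx).
    subst x.
    intros [eps He]. apply (proj1 (locally_C z _)), locally_C_eps.
    destruct (Hf eps He) as [d [d0 Hd]]. exists d. split; [exact d0|].
    intros w Hw. specialize (Hd w Hw). rewrite (Cmult_comm l) in Hd. exact Hd.
Qed.

Lemma ex_derive_continuous_C (f : C -> C) (z : C) :
  @ex_derive C_AbsRing C_NormedModule f z -> continuous f z.
Proof.
  intros [l Hl]. apply continuous_C_eps. intros eps He.
  apply locally_C_eps.
  destruct (proj1 (is_derive_C_eps f z l) Hl 1 Rlt_0_1) as [d [d0 Hd]].
  pose proof (Cmod_ge_0 l) as L0.
  exists (Rmin d (eps / (Cmod l + 1))). split.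
  { apply Rmin_glb_lt; [exact d0|]. apply Rdiv_lt_0_compat; lra. }
  intros w Hw.
  assert (H1 := Hd w (Rlt_le_trans _ _ _ Hw (Rmin_l _ _))).
  assert (H2 := Rlt_le_trans _ _ _ Hw (Rmin_r _ _)).
  replace (f w - f z)%C with ((f w - f z - l * (w - z)) + l * (w - z))%C by ring.
  eapply Rle_lt_trans; [apply Cmod_triangle|]. rewrite Cmod_mult.
  apply Rlt_div_r in H2; lra.
Qed.

Lemma is_derive_Cplus (f g : C -> C) (z a b : C) :
  is_derive f z a -> is_derive g z b ->
  is_derive (fun x => f x + g x)%C z (a + b)%C.
Proof. exact (is_derive_plus f g z a b). Qed.

Lemma is_derive_Cminus (f g : C -> C) (z a b : C) :
  is_derive f z a -> is_derive g z b ->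
  is_derive (fun x => f x - g x)%C z (a - b)%C.
Proof. exact (is_derive_minus f g z a b). Qed.

(** [C_AbsRing] and [C_NormedModule] put different uniform structures on [C]
    (balls of the modulus against products of intervals).  Domination only sees
    the norm, which they share; this bridges to library lemmas in which the
    codomain of the function is the scalar field itself. *)
Lemma is_derive_C_AbsRing (f : C -> C) (z l : C) :
  @is_derive C_AbsRing (AbsRing_NormedModule C_AbsRing) f z l <-> is_derive f z l.
Proof.
  split; intros [_ H]; (split; [apply is_linear_scal_l | exact H]).
Qed.

Lemma is_derive_Cmult (f g : C -> C) (z a b : C) :
  is_derive f z a -> is_derive g z b ->
  is_derive (fun x => f x * g x)%C z (a * g z + f z * b)%C.
Proof.
  rewrite <- !is_derive_C_AbsRing. intros Hf Hg.
  exact (is_derive_mult f g z a b Hf Hg Cmult_comm).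
Qed.

Lemma is_derive_Cconst (c z : C) : is_derive (fun _ : C => c) z (RtoC 0).
Proof. exact (is_derive_const c z). Qed.

Lemma is_derive_Cid (z : C) : is_derive (fun x : C => x) z (RtoC 1).
Proof. apply is_derive_C_AbsRing. exact (is_derive_id z). Qed.

Lemma is_derive_Ccomp (f g : C -> C) (z a b : C) :
  is_derive f (g z) a -> is_derive g z b ->
  is_derive (fun x => f (g x)) z (b * a)%C.
Proof.
  rewrite <- (is_derive_C_AbsRing g). exact (is_derive_comp f g z a b).
Qed.

Lemma is_derive_Cinv (z : C) :
  z <> RtoC 0 -> is_derive Cinv z (- / (z * z))%C.
Proof.
  intros Hz. apply is_derive_C_eps. intros eps He.
  assert (Z0 : 0 < Cmod z) by (apply Cmod_gt_0; exact Hz).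
  exists (Rmin (Cmod z / 2) (eps * (Cmod z * Cmod z * Cmod z) / 2)). split.
  { apply Rmin_glb_lt; [lra|].
    apply Rdiv_lt_0_compat; [|lra]. repeat apply Rmult_lt_0_compat; lra. }
  intros w Hw.
  assert (H1 := Rlt_le_trans _ _ _ Hw (Rmin_l _ _)).
  assert (H2 := Rlt_le_trans _ _ _ Hw (Rmin_r _ _)).
  assert (W0 : Cmod z / 2 < Cmod w).
  { assert (Cmod z <= Cmod (w - z) + Cmod w).
    { rewrite <- (Cmod_opp (w - z)).
      replace (Cmod z) with (Cmod (- (w - z) + w)) by (f_equal; ring).
      apply Cmod_triangle. }
    lra. }
  assert (Hw0 : w <> RtoC 0).
  { intros ->. rewrite Cmod_0 in W0. lra. }
  replace (/ w - / z - - / (z * z) * (w - z))%C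
    with ((w - z) * ((w - z) / (z * z * w)))%C by (field; auto).
  rewrite Cmod_mult, Rmult_comm. apply Rmult_le_compat_r; [apply Cmod_ge_0|].
  rewrite Cmod_div by (repeat apply Cmult_neq_0; auto).
  rewrite !Cmod_mult.
  apply Rle_div_l; [repeat apply Rmult_lt_0_compat; lra|].
  apply Rlt_le. eapply Rlt_le_trans; [exact H2|].
  assert (eps * (Cmod z * Cmod z) * (Cmod z / 2) <= eps * (Cmod z * Cmod z) * Cmod w).
  { apply Rmult_le_compat_l; [|lra]. apply Rlt_le. repeat apply Rmult_lt_0_compat; lra. }
  lra.
Qed.

(** * Continuity and integrals of complex-valued functions *)

Lemma continuous_C_iff {T : UniformSpace} (f : T -> C) (x : T) :
  continuous f x <->
  continuous (fun t => Re (f t)) x /\ continuous (fun t => Im (f t)) x.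
Proof.
  split.
  - intros Hf. split.
    + apply (continuous_comp f (fun z : C => fst z)); [exact Hf|].
      destruct (f x) as [u v]. exact (continuous_fst u v).
    + apply (continuous_comp f (fun z : C => snd z)); [exact Hf|].
      destruct (f x) as [u v]. exact (continuous_snd u v).
  - intros [H1 H2]. apply continuous_C_eps. intros eps He.
    assert (E2 : 0 < eps / 2) by lra.
    generalize (filter_and _ _ (proj1 (filterlim_locally _ _) H1 (mkposreal _ E2))
                               (proj1 (filterlim_locally _ _) H2 (mkposreal _ E2))).
    apply filter_imp. intros t [B A].
    assert (A' : Rabs (Im (f t) - Im (f x)) < eps / 2) by exact A.
    assert (B' : Rabs (Re (f t) - Re (f x)) < eps / 2) by exact B.
    eapply Rle_lt_trans with (Rabs (Re (f t) - Re (f x)) + Rabs (Im (f t) - Im (f x))); [|lra].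
    replace (f t - f x)%C with (RtoC (Re (f t) - Re (f x)) + Ci * RtoC (Im (f t) - Im (f x)))%C
      by (apply injective_projections; unfold Re, Im; simpl; ring).
    eapply Rle_trans; [apply Cmod_triangle|].
    rewrite Cmod_mult, !Cmod_R, Cmod_Ci. lra.
Qed.

Lemma continuous_Cplus {T : UniformSpace} (f g : T -> C) (x : T) :
  continuous f x -> continuous g x -> continuous (fun t => f t + g t)%C x.
Proof.
  rewrite !continuous_C_iff. intros [F1 F2] [G1 G2]. split.
  - exact (continuous_plus _ _ _ F1 G1).
  - exact (continuous_plus _ _ _ F2 G2).
Qed.

Lemma continuous_Cmult {T : UniformSpace} (f g : T -> C) (x : T) :
  continuous f x -> continuous g x -> continuous (fun t => f t * g t)%C x.
Proof.
  rewrite !continuous_C_iff. intros [F1 F2] [G1 G2]. split.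
  - exact (continuous_minus (V := R_NormedModule) _ _ _
             (continuous_mult (K := R_AbsRing) _ _ _ F1 G1)
             (continuous_mult (K := R_AbsRing) _ _ _ F2 G2)).
  - exact (continuous_plus (V := R_NormedModule) _ _ _
             (continuous_mult (K := R_AbsRing) _ _ _ F1 G2)
             (continuous_mult (K := R_AbsRing) _ _ _ F2 G1)).
Qed.

Lemma continuous_Cminus {T : UniformSpace} (f g : T -> C) (x : T) :
  continuous f x -> continuous g x -> continuous (fun t => f t - g t)%C x.
Proof.
  rewrite !continuous_C_iff. intros [F1 F2] [G1 G2]. split.
  - exact (continuous_minus _ _ _ F1 G1).
  - exact (continuous_minus _ _ _ F2 G2).
Qed.

Lemma continuous_Cconst {T : UniformSpace} (c : C) (x : T) :
  continuous (fun _ : T => c) x.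
Proof. apply continuous_const. Qed.

Lemma continuous_Cinv {T : UniformSpace} (f : T -> C) (x : T) :
  continuous f x -> f x <> RtoC 0 -> continuous (fun t => / f t)%C x.
Proof.
  intros Hf H0. apply (continuous_comp f Cinv); [exact Hf|].
  apply ex_derive_continuous_C. eexists. apply is_derive_Cinv, H0.
Qed.

Lemma continuous_Cpow {T : UniformSpace} (f : T -> C) (n : nat) (x : T) :
  continuous f x -> continuous (fun t => f t ^ n)%C x.
Proof.
  intros Hf. induction n as [|n IH]; [apply continuous_Cconst|].
  exact (continuous_Cmult _ _ _ Hf IH).
Qed.

Definition CInt (f : R -> C) (a b : R) : C :=
  (RInt (fun t => Re (f t)) a b, RInt (fun t => Im (f t)) a b).

Definition continuous_on_itv (f : R -> C) (a b : R) : Prop :=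
  forall t : R, a <= t <= b -> continuous f t.

Lemma continuous_on_ex_RInt (f : R -> C) (a b : R) :
  a <= b -> continuous_on_itv f a b ->
  ex_RInt (fun t => Re (f t)) a b /\ ex_RInt (fun t => Im (f t)) a b.
Proof.
  intros ab Hf.
  split; apply (ex_RInt_continuous (V := R_CompleteNormedModule)); intros t Ht;
    rewrite Rmin_left, Rmax_right in Ht by exact ab;
    apply (continuous_C_iff f t), Hf, Ht.
Qed.

Lemma CInt_ext (f g : R -> C) (a b : R) :
  a <= b -> (forall t, a <= t <= b -> f t = g t) -> CInt f a b = CInt g a b.
Proof.
  intros ab H. unfold CInt.
  f_equal; apply RInt_ext; intros t Ht;
    rewrite Rmin_left, Rmax_right in Ht by exact ab; rewrite H; auto; lra.
Qed.

Lemma CInt_plus (f g : R -> C) (a b : R) :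
  a <= b -> continuous_on_itv f a b -> continuous_on_itv g a b ->
  CInt (fun t => f t + g t)%C a b = (CInt f a b + CInt g a b)%C.
Proof.
  intros ab Hf Hg.
  destruct (continuous_on_ex_RInt f a b ab Hf) as [F1 F2].
  destruct (continuous_on_ex_RInt g a b ab Hg) as [G1 G2].
  apply injective_projections.
  - exact (RInt_plus _ _ _ _ F1 G1).
  - exact (RInt_plus _ _ _ _ F2 G2).
Qed.

Lemma CInt_minus (f g : R -> C) (a b : R) :
  a <= b -> continuous_on_itv f a b -> continuous_on_itv g a b ->
  CInt (fun t => f t - g t)%C a b = (CInt f a b - CInt g a b)%C.
Proof.
  intros ab Hf Hg.
  destruct (continuous_on_ex_RInt f a b ab Hf) as [F1 F2].
  destruct (continuous_on_ex_RInt g a b ab Hg) as [G1 G2].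
  apply injective_projections.
  - exact (RInt_minus _ _ _ _ F1 G1).
  - exact (RInt_minus _ _ _ _ F2 G2).
Qed.

(** [RInt] is linear over real scalars only; a complex scalar mixes the two
    components. *)
Lemma CInt_scal (c : C) (f : R -> C) (a b : R) :
  a <= b -> continuous_on_itv f a b ->
  CInt (fun t => c * f t)%C a b = (c * CInt f a b)%C.
Proof.
  intros ab Hf.
  destruct (continuous_on_ex_RInt f a b ab Hf) as [F1 F2].
  assert (S : forall (k : R) (g : R -> R), ex_RInt g a b ->
            ex_RInt (fun t => k * g t) a b)
    by (intros k g Hg; exact (ex_RInt_scal g a b k Hg)).
  assert (E : forall (k : R) (g : R -> R), ex_RInt g a b ->
            RInt (fun t => k * g t) a b = k * RInt g a b)
    by (intros k g Hg; exact (RInt_scal g a b k Hg)).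
  apply injective_projections; simpl.
  - rewrite <- !E by assumption.
    exact (RInt_minus (V := R_CompleteNormedModule) _ _ _ _ (S _ _ F1) (S _ _ F2)).
  - rewrite <- !E by assumption.
    exact (RInt_plus (V := R_CompleteNormedModule) _ _ _ _ (S _ _ F2) (S _ _ F1)).
Qed.

Lemma CInt_conj (f : R -> C) (a b : R) :
  a <= b -> continuous_on_itv f a b ->
  CInt (fun t => Cconj (f t)) a b = Cconj (CInt f a b).
Proof.
  intros ab Hf.
  destruct (continuous_on_ex_RInt f a b ab Hf) as [F1 F2].
  apply injective_projections; [reflexivity|].
  exact (RInt_opp _ _ _ F2).
Qed.

Lemma CInt_const (c : C) (a b : R) :
  CInt (fun _ => c) a b = (RtoC (b - a) * c)%C.
Proof.
  unfold CInt. rewrite !RInt_const.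
  apply injective_projections; unfold scal, Re, Im; simpl; unfold mult; simpl; ring.
Qed.

Lemma CInt_Chasles (f : R -> C) (a b c : R) :
  a <= b -> b <= c -> continuous_on_itv f a c ->
  (CInt f a b + CInt f b c)%C = CInt f a c.
Proof.
  intros ab bc Hf.
  destruct (continuous_on_ex_RInt f a b ab) as [F1 F2];
    [intros t Ht; apply Hf; lra|].
  destruct (continuous_on_ex_RInt f b c bc) as [G1 G2];
    [intros t Ht; apply Hf; lra|].
  apply injective_projections.
  - exact (RInt_Chasles _ _ _ _ F1 G1).
  - exact (RInt_Chasles _ _ _ _ F2 G2).
Qed.

(** The pair of component integrals is also the integral with values in the
    real normed module [C], whose norm is the modulus; going through it avoids
    the factor that separate bounds on the components would cost. *)
Lemma CInt_bound (f : R -> C) (a b M : R) :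
  a <= b -> continuous_on_itv f a b ->
  (forall t, a <= t <= b -> Cmod (f t) <= M) ->
  Cmod (CInt f a b) <= M * (b - a).
Proof.
  intros ab Hf HM.
  destruct (continuous_on_ex_RInt f a b ab Hf) as [F1 F2].
  assert (H : is_RInt (V := C_R_NormedModule) f a b (CInt f a b)).
  { apply (is_RInt_fct_extend_pair (U := R_NormedModule) (V := R_NormedModule));
      apply (RInt_correct (V := R_CompleteNormedModule)); assumption. }
  rewrite Rmult_comm, Cmod_norm.
  apply (norm_RInt_le_const (V := C_R_NormedModule) f a b (CInt f a b) M ab); [|exact H].
  intros x Hx. rewrite <- Cmod_norm. apply HM, Hx.
Qed.

Lemma CInt_primitive (f F : R -> C) (a b : R) :
  a <= b -> continuous_on_itv f a b ->
  (forall t, a <= t <= b -> is_derive (fun t => Re (F t)) t (Re (f t))) ->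
  (forall t, a <= t <= b -> is_derive (fun t => Im (F t)) t (Im (f t))) ->
  CInt f a b = (F b - F a)%C.
Proof.
  intros ab Hf H1 H2.
  apply injective_projections; simpl; apply is_RInt_unique.
  - apply (is_RInt_derive (V := R_CompleteNormedModule) (fun t => Re (F t)));
      intros t Ht; rewrite Rmin_left, Rmax_right in Ht by exact ab;
      [apply H1, Ht | apply (continuous_C_iff f t), Hf, Ht].
  - apply (is_RInt_derive (V := R_CompleteNormedModule) (fun t => Im (F t)));
      intros t Ht; rewrite Rmin_left, Rmax_right in Ht by exact ab;
      [apply H2, Ht | apply (continuous_C_iff f t), Hf, Ht].
Qed.

(** * Goursat's theorem for rectangles *)

(** The counterclockwise integral of [h z dz] along the boundary of
    [[a, b] x [c, d]]; the vertical edges carry [dz = i dy]. *)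
Definition rect_integral (h : C -> C) (a b c d : R) : C :=
  (CInt (fun x => h (x, c)) a b + Ci * CInt (fun y => h (b, y)) c d
   - CInt (fun x => h (x, d)) a b - Ci * CInt (fun y => h (a, y)) c d)%C.

Definition continuous_on_rect (h : C -> C) (a b c d : R) : Prop :=
  forall x y : R, a <= x <= b -> c <= y <= d -> continuous h (x, y).

Lemma continuous_on_horizontal (h : C -> C) (a b c d y : R) :
  continuous_on_rect h a b c d -> c <= y <= d ->
  continuous_on_itv (fun x => h (x, y)) a b.
Proof.
  intros Hh Hy x Hx.
  apply (continuous_comp (fun t : R => ((t, y) : C)) h); [|apply Hh; assumption].
  apply continuous_C_iff. split; [apply continuous_id | apply continuous_const].
Qed.

Lemma continuous_on_vertical (h : C -> C) (a b c d x : R) :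
  continuous_on_rect h a b c d -> a <= x <= b ->
  continuous_on_itv (fun y => h (x, y)) c d.
Proof.
  intros Hh Hx y Hy.
  apply (continuous_comp (fun t : R => ((x, t) : C)) h); [|apply Hh; assumption].
  apply continuous_C_iff. split; [apply continuous_const | apply continuous_id].
Qed.

(** The integrals along inner edges cancel in pairs. *)
Lemma rect_integral_split (h : C -> C) (a m b c n d : R) :
  a <= m <= b -> c <= n <= d -> continuous_on_rect h a b c d ->
  rect_integral h a b c d =
  (rect_integral h a m c n + rect_integral h m b c n +
   rect_integral h a m n d + rect_integral h m b n d)%C.
Proof.
  intros Hm Hn Hh. unfold rect_integral.
  rewrite <- (CInt_Chasles (fun x => h (x, c)) a m b);
    [|lra|lra|eapply continuous_on_horizontal; [exact Hh|lra]].
  rewrite <- (CInt_Chasles (fun x => h (x, d)) a m b);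
    [|lra|lra|eapply continuous_on_horizontal; [exact Hh|lra]].
  rewrite <- (CInt_Chasles (fun y => h (a, y)) c n d);
    [|lra|lra|eapply continuous_on_vertical; [exact Hh|lra]].
  rewrite <- (CInt_Chasles (fun y => h (b, y)) c n d);
    [|lra|lra|eapply continuous_on_vertical; [exact Hh|lra]].
  ring.
Qed.

Lemma rect_integral_minus (h g : C -> C) (a b c d : R) :
  a <= b -> c <= d ->
  continuous_on_rect h a b c d -> continuous_on_rect g a b c d ->
  rect_integral (fun z => h z - g z)%C a b c d =
  (rect_integral h a b c d - rect_integral g a b c d)%C.
Proof.
  intros ab cd Hh Hg. unfold rect_integral.
  rewrite (CInt_minus (fun x => h (x, c)) (fun x => g (x, c)) a b);
    [|exact ab|apply (continuous_on_horizontal h a b c d); [exact Hh|lra]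
              |apply (continuous_on_horizontal g a b c d); [exact Hg|lra]].
  rewrite (CInt_minus (fun x => h (x, d)) (fun x => g (x, d)) a b);
    [|exact ab|apply (continuous_on_horizontal h a b c d); [exact Hh|lra]
              |apply (continuous_on_horizontal g a b c d); [exact Hg|lra]].
  rewrite (CInt_minus (fun y => h (a, y)) (fun y => g (a, y)) c d);
    [|exact cd|apply (continuous_on_vertical h a b c d); [exact Hh|lra]
              |apply (continuous_on_vertical g a b c d); [exact Hg|lra]].
  rewrite (CInt_minus (fun y => h (b, y)) (fun y => g (b, y)) c d);
    [|exact cd|apply (continuous_on_vertical h a b c d); [exact Hh|lra]
              |apply (continuous_on_vertical g a b c d); [exact Hg|lra]].
  ring.
Qed.

Lemma rect_integral_bound (h : C -> C) (a b c d M : R) :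
  a <= b -> c <= d -> continuous_on_rect h a b c d ->
  (forall x y, a <= x <= b -> c <= y <= d -> Cmod (h (x, y)) <= M) ->
  Cmod (rect_integral h a b c d) <= 2 * M * ((b - a) + (d - c)).
Proof.
  intros ab cd Hh HM. unfold rect_integral, Cminus.
  assert (B1 := CInt_bound (fun x => h (x, c)) a b M ab
    (continuous_on_horizontal _ _ _ _ _ c Hh (conj (Rle_refl c) cd))
    (fun x Hx => HM x c Hx (conj (Rle_refl c) cd))).
  assert (B2 := CInt_bound (fun x => h (x, d)) a b M ab
    (continuous_on_horizontal _ _ _ _ _ d Hh (conj cd (Rle_refl d)))
    (fun x Hx => HM x d Hx (conj cd (Rle_refl d)))).
  assert (B3 := CInt_bound (fun y => h (a, y)) c d M cd
    (continuous_on_vertical _ _ _ _ _ a Hh (conj (Rle_refl a) ab))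
    (fun y Hy => HM a y (conj (Rle_refl a) ab) Hy)).
  assert (B4 := CInt_bound (fun y => h (b, y)) c d M cd
    (continuous_on_vertical _ _ _ _ _ b Hh (conj ab (Rle_refl b)))
    (fun y Hy => HM b y (conj ab (Rle_refl b)) Hy)).
  eapply Rle_trans; [apply Cmod_triangle|].
  eapply Rle_trans; [apply Rplus_le_compat_r, Cmod_triangle|].
  eapply Rle_trans; [apply Rplus_le_compat_r, Rplus_le_compat_r, Cmod_triangle|].
  rewrite !Cmod_opp, !Cmod_mult, Cmod_Ci. lra.
Qed.

(** An affine function has an explicit primitive along every edge. *)
Lemma rect_integral_affine (A B : C) (a b c d : R) :
  a <= b -> c <= d -> rect_integral (fun z => A + B * z)%C a b c d = RtoC 0.
Proof.
  intros ab cd.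
  assert (K : continuous_on_rect (fun z => A + B * z)%C a b c d).
  { intros x y _ _. apply continuous_Cplus; [apply continuous_Cconst|].
    apply continuous_Cmult; [apply continuous_Cconst | apply continuous_id]. }
  assert (Hx : forall y, c <= y <= d ->
    CInt (fun x => A + B * (x, y))%C a b =
    (RtoC (b - a) * (A + B * (((a + b) / 2)%R, y)))%C).
  { intros y Hy.
    rewrite (CInt_primitive _
      (fun x => A * RtoC x + B * ((x * x / 2)%R, (x * y)%R))%C);
      [|exact ab|exact (continuous_on_horizontal _ _ _ _ _ _ K Hy)| |].
    - apply injective_projections; simpl; field.
    - intros x _. unfold Re; simpl. auto_derive; [exact I|field].
    - intros x _. unfold Im; simpl. auto_derive; [exact I|field]. }
  assert (Hy : forall x, a <= x <= b ->
    CInt (fun y => A + B * (x, y))%C c d =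
    (RtoC (d - c) * (A + B * (x, ((c + d) / 2)%R)))%C).
  { intros x Hx'.
    rewrite (CInt_primitive _
      (fun y => A * RtoC y + B * ((x * y)%R, (y * y / 2)%R))%C);
      [|exact cd|exact (continuous_on_vertical _ _ _ _ _ _ K Hx')| |].
    - apply injective_projections; simpl; field.
    - intros y _. unfold Re; simpl. auto_derive; [exact I|field].
    - intros y _. unfold Im; simpl. auto_derive; [exact I|field]. }
  unfold rect_integral.
  rewrite !Hx, !Hy by lra.
  destruct A as [A1 A2], B as [B1 B2].
  apply injective_projections; simpl; field.
Qed.

(** The lower ends increase, the upper ends decrease; the point is the supremum
    of the lower ends. *)
Lemma nested_dyadic_point (x : nat -> R) (w : R) :
  0 <= w ->
  (forall n, x (S n) = x n \/ x (S n) = x n + w / 2 ^ S n) ->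
  exists l, forall n, x n <= l <= x n + w / 2 ^ n.
Proof.
  intros Hw Hx.
  assert (P : forall n, 0 < 2 ^ n) by (intros n; apply pow_lt; lra).
  assert (W : forall n, 0 <= w / 2 ^ S n /\ w / 2 ^ n = 2 * (w / 2 ^ S n)).
  { intros n. split.
    - apply Rdiv_le_0_compat; [exact Hw | apply P].
    - simpl. field. apply Rgt_not_eq, P. }
  assert (M : forall n k,
    x n <= x (n + k)%nat /\ x (n + k)%nat + w / 2 ^ (n + k) <= x n + w / 2 ^ n).
  { intros n. induction k as [|k IH].
    - rewrite Nat.add_0_r. lra.
    - rewrite Nat.add_succ_r. destruct (W (n + k)%nat) as [W1 W2].
      destruct (Hx (n + k)%nat) as [E|E]; rewrite E; lra. }
  assert (Hub : forall n m, x m <= x n + w / 2 ^ n).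
  { intros n m.
    assert (W0 : forall n, 0 <= w / 2 ^ n)
      by (intros i; apply Rdiv_le_0_compat; [exact Hw | apply P]).
    pose proof (W0 m). pose proof (W0 n).
    destruct (Nat.le_ge_cases n m) as [H'|H'].
    - destruct (M n (m - n)%nat) as [M1 M2].
      replace (n + (m - n))%nat with m in * by lia. lra.
    - destruct (M m (n - m)%nat) as [M1 M2].
      replace (m + (n - m))%nat with n in * by lia. lra. }
  destruct (completeness (fun y => exists n, y = x n)) as [l [L1 L2]].
  - exists (x 0%nat + w / 2 ^ 0). intros y [n ->]. apply Hub.
  - exists (x 0%nat). exists 0%nat. reflexivity.
  - exists l. intros n. split.
    + apply L1. exists n. reflexivity.
    + apply L2. intros y [m ->]. apply Hub.
Qed.

(** One bisection step, encoded by lower left corners: for the rectangle of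
    sides [2 w] and [2 v] at [s], the first of three of its quarters whose
    integral has at least a quarter of the total modulus, and the fourth
    quarter by default.  Deciding real inequalities makes this a function that
    can be iterated without any choice. *)
Definition worst_quarter (h : C -> C) (w v : R) (s : R * R) : R * R :=
  let (x, y) := s in
  let big x y :=
    4 * Cmod (rect_integral h x (x + w) y (y + v)) in
  let total := Cmod (rect_integral h (fst s) (fst s + 2 * w) (snd s) (snd s + 2 * v)) in
  if Rle_dec total (big x y) then (x, y)
  else if Rle_dec total (big (x + w) y) then (x + w, y)
  else if Rle_dec total (big x (y + v)) then (x, y + v)
  else (x + w, y + v).

Lemma worst_quarter_spec (h : C -> C) (w v x y x' y' : R) :
  0 <= w -> 0 <= v -> continuous_on_rect h x (x + 2 * w) y (y + 2 * v) ->
  worst_quarter h w v (x, y) = (x', y') ->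
  (x' = x \/ x' = x + w) /\ (y' = y \/ y' = y + v) /\
  Cmod (rect_integral h x (x + 2 * w) y (y + 2 * v)) <=
  4 * Cmod (rect_integral h x' (x' + w) y' (y' + v)).
Proof.
  intros Hw Hv Hh. unfold worst_quarter. simpl.
  destruct (Rle_dec _ _) as [A|A]; [intros [= <- <-]; auto|].
  destruct (Rle_dec _ _) as [B|B]; [intros [= <- <-]; auto|].
  destruct (Rle_dec _ _) as [D|D]; [intros [= <- <-]; auto|].
  intros [= <- <-]. split; [auto|]. split; [auto|].
  rewrite (rect_integral_split h x (x + w) (x + 2 * w) y (y + v) (y + 2 * v))
    in *; try lra; try exact Hh.
  replace (x + w + w) with (x + 2 * w) in * by ring.
  replace (y + v + v) with (y + 2 * v) in * by ring.
  set (R1 := rect_integral h x (x + w) y (y + v)) in *.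
  set (R2 := rect_integral h (x + w) (x + 2 * w) y (y + v)) in *.
  set (R3 := rect_integral h x (x + w) (y + v) (y + 2 * v)) in *.
  set (R4 := rect_integral h (x + w) (x + 2 * w) (y + v) (y + 2 * v)) in *.
  pose proof (Cmod_triangle (R1 + R2 + R3) R4).
  pose proof (Cmod_triangle (R1 + R2) R3).
  pose proof (Cmod_triangle R1 R2).
  lra.
Qed.

(** Bisection yields nested rectangles of sides [w / 2^n], [v / 2^n] whose
    integrals are at least [4^(-n)] times the total one.  They shrink to a
    point, near which [h] differs from an affine function by at most
    [eps * distance]; as affine functions integrate to zero, the [n]-th integral
    is at most [2 eps ((w + v) / 2^n)^2].  So the total is at most
    [2 eps (w + v)^2] for every [eps]. *)
Theorem goursat (h : C -> C) (a b c d : R) :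
  a <= b -> c <= d ->
  (forall x y, a <= x <= b -> c <= y <= d ->
     @ex_derive C_AbsRing C_NormedModule h (x, y)) ->
  rect_integral h a b c d = RtoC 0.
Proof.
  intros ab cd Hd.
  assert (Hh : continuous_on_rect h a b c d)
    by (intros x y Hx Hy; apply ex_derive_continuous_C, Hd; assumption).
  set (w := b - a). set (v := d - c).
  set (s := fix s (n : nat) : R * R := match n with
            | O => (a, c)
            | S n => worst_quarter h (w / 2 ^ S n) (v / 2 ^ S n) (s n)
            end).
  assert (P : forall n, 0 < 2 ^ n) by (intros n; apply pow_lt; lra).
  assert (W0 : forall n, 0 <= w / 2 ^ n)
    by (intros n; apply Rdiv_le_0_compat; [unfold w; lra | apply P]).
  assert (V0 : forall n, 0 <= v / 2 ^ n)
    by (intros n; apply Rdiv_le_0_compat; [unfold v; lra | apply P]).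
  assert (Half : forall u n, u / 2 ^ n = 2 * (u / 2 ^ S n))
    by (intros u n; simpl; field; apply Rgt_not_eq, P).
  set (J := fun n => Cmod (rect_integral h (fst (s n)) (fst (s n) + w / 2 ^ n)
                                         (snd (s n)) (snd (s n) + v / 2 ^ n))).
  assert (Step : forall n,
    (a <= fst (s n) /\ fst (s n) + w / 2 ^ n <= b) /\
    (c <= snd (s n) /\ snd (s n) + v / 2 ^ n <= d) ->
    (fst (s (S n)) = fst (s n) \/ fst (s (S n)) = fst (s n) + w / 2 ^ S n) /\
    (snd (s (S n)) = snd (s n) \/ snd (s (S n)) = snd (s n) + v / 2 ^ S n) /\
    J n <= 4 * J (S n)).
  { intros n [Hx Hy]. unfold J. rewrite (Half w n), (Half v n) in *.
    change (s (S n)) with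
      (worst_quarter h (w / 2 ^ S n) (v / 2 ^ S n) (s n)).
    destruct (s n) as [x y].
    apply worst_quarter_spec; [apply W0|apply V0| |apply surjective_pairing].
    intros p q Hp Hq. apply Hh; simpl in *; lra. }
  assert (In : forall n,
    (a <= fst (s n) /\ fst (s n) + w / 2 ^ n <= b) /\
    (c <= snd (s n) /\ snd (s n) + v / 2 ^ n <= d)).
  { induction n as [|n IH].
    - simpl. unfold w, v. lra.
    - destruct (Step n IH) as [Sx [Sy _]].
      pose proof (W0 (S n)). pose proof (V0 (S n)).
      pose proof (Half w n). pose proof (Half v n).
      split; [destruct Sx as [E|E] | destruct Sy as [E|E]]; rewrite E; lra. }
  assert (JJ : forall n, J 0%nat <= 4 ^ n * J n).
  { induction n as [|n IH]; [simpl; lra|].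
    destruct (Step n (In n)) as [_ [_ E]].
    assert (0 < 4 ^ n) by (apply pow_lt; lra).
    simpl. nra. }
  destruct (nested_dyadic_point (fun n => fst (s n)) w) as [x Hx];
    [unfold w; lra | intros n; apply (Step n (In n))|].
  destruct (nested_dyadic_point (fun n => snd (s n)) v) as [y Hy];
    [unfold v; lra | intros n; apply (Step n (In n))|].
  assert (Hxy : a <= x <= b /\ c <= y <= d).
  { specialize (Hx 0%nat). specialize (Hy 0%nat).
    destruct (In 0%nat) as [I1 I2]. lra. }
  destruct (Hd x y (proj1 Hxy) (proj2 Hxy)) as [l Hl].
  assert (Jdef : J 0%nat = Cmod (rect_integral h a b c d)).
  { unfold J. simpl. f_equal. f_equal; unfold w, v; field. }
  destruct (Req_dec (J 0%nat) 0) as [E|E];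
    [apply Cmod_eq_0; rewrite <- Jdef; exact E|].
  assert (J0 : 0 < J 0%nat)
    by (destruct (Cmod_ge_0 (rect_integral h a b c d)); lra).
  exfalso.
  set (T := w + v).
  assert (T0 : 0 <= T) by (unfold T, w, v; lra).
  (* Small enough that [2 eps T^2 < J 0], with room for [T = 0]. *)
  set (eps := J 0%nat / (2 * (T * T) + 1)).
  assert (D0 : 0 < 2 * (T * T) + 1) by nra.
  assert (E0 : 0 < eps) by (apply Rdiv_lt_0_compat; lra).
  destruct (proj1 (is_derive_C_eps h (x, y) l) Hl eps E0) as [del [del0 Hdel]].
  destruct (pow_lt_1_zero (/ 2)) with (y := del / (T + 1)) as [N HN].
  { rewrite Rabs_pos_eq; lra. }
  { apply Rdiv_lt_0_compat; lra. }
  specialize (HN N (Nat.le_refl N)).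
  rewrite Rabs_pos_eq in HN by (apply pow_le; lra).
  rewrite pow_inv in HN.
  assert (TN : T / 2 ^ N < del).
  { apply Rlt_div_r in HN; [|lra].
    unfold Rdiv. rewrite Rmult_comm.
    pose proof (Rinv_0_lt_compat _ (P N)). nra. }
  assert (dist : forall p q, fst (s N) <= p <= fst (s N) + w / 2 ^ N ->
                 snd (s N) <= q <= snd (s N) + v / 2 ^ N ->
                 Cmod ((p, q) - (x, y)) <= T / 2 ^ N).
  { intros p q Hp Hq. specialize (Hx N). specialize (Hy N). simpl in Hx, Hy.
    replace ((p, q) - (x, y))%C with (RtoC (p - x) + Ci * RtoC (q - y))%C
      by (apply injective_projections; simpl; ring).
    eapply Rle_trans; [apply Cmod_triangle|].
    rewrite Cmod_mult, !Cmod_R, Cmod_Ci.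
    assert (Rabs (p - x) <= w / 2 ^ N) by (apply Rabs_le; lra).
    assert (Rabs (q - y) <= v / 2 ^ N) by (apply Rabs_le; lra).
    unfold T. rewrite Rdiv_plus_distr. lra. }
  destruct (In N) as [[I1 I2] [I3 I4]].
  set (aff := fun z : C => (h (x, y) - l * (x, y) + l * z)%C).
  assert (Caff : forall a b c d, continuous_on_rect aff a b c d).
  { intros ? ? ? ? p q _ _. apply continuous_Cplus; [apply continuous_Cconst|].
    apply continuous_Cmult; [apply continuous_Cconst | apply continuous_id]. }
  assert (CN : continuous_on_rect h (fst (s N)) (fst (s N) + w / 2 ^ N)
                 (snd (s N)) (snd (s N) + v / 2 ^ N)).
  { intros p q Hp Hq. apply Hh; lra. }
  assert (JN : J N <= 2 * (eps * (T / 2 ^ N)) * (T / 2 ^ N)).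
  { unfold J.
    pose proof (W0 N). pose proof (V0 N).
    replace (rect_integral h (fst (s N)) (fst (s N) + w / 2 ^ N)
               (snd (s N)) (snd (s N) + v / 2 ^ N))
      with (rect_integral (fun z => h z - aff z)%C
               (fst (s N)) (fst (s N) + w / 2 ^ N)
               (snd (s N)) (snd (s N) + v / 2 ^ N)).
    2:{ rewrite rect_integral_minus; [|lra|lra|exact CN|apply Caff].
        unfold aff. rewrite rect_integral_affine by lra. ring. }
    replace (T / 2 ^ N) with ((fst (s N) + w / 2 ^ N - fst (s N)) +
      (snd (s N) + v / 2 ^ N - snd (s N))) at 2
      by (unfold T; rewrite Rdiv_plus_distr; ring).
    apply rect_integral_bound; [lra|lra| |].
    - intros p q Hp Hq. apply continuous_Cminus; [apply CN; assumption|].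
      apply (Caff p p q q); lra.
    - intros p q Hp Hq. specialize (dist p q Hp Hq).
      eapply Rle_trans; [|apply Rmult_le_compat_l; [lra|exact dist]].
      replace (h (p, q) - aff (p, q))%C
        with (h (p, q) - h (x, y) - l * ((p, q) - (x, y)))%C
        by (unfold aff; ring).
      apply Hdel. lra. }
  specialize (JJ N).
  assert (Q : 4 ^ N * J N <= 2 * eps * (T * T)).
  { eapply Rle_trans; [apply Rmult_le_compat_l; [apply pow_le; lra|exact JN]|].
    right. replace (4 ^ N) with (2 ^ N * 2 ^ N)
      by (rewrite <- Rpow_mult_distr; f_equal; lra).
    field. apply Rgt_not_eq, P. }
  assert (eps * (2 * (T * T) + 1) = J 0%nat) by (unfold eps; field; lra).
  lra.
Qed.

(** * The mean value property on circles *)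

Lemma Cmod_cis (t : R) : Cmod (cis t) = 1.
Proof.
  unfold Cmod, cis; simpl. rewrite !Rmult_1_r.
  replace (cos t * cos t + sin t * sin t) with 1; [apply sqrt_1|].
  generalize (sin2_cos2 t). unfold Rsqr. lra.
Qed.

Lemma cis_plus (s t : R) : cis (s + t) = (cis s * cis t)%C.
Proof.
  apply injective_projections; simpl; [rewrite cos_plus | rewrite sin_plus]; ring.
Qed.

Definition cexp (z : C) : C := (RtoC (exp (Re z)) * cis (Im z))%C.

Lemma cexp_plus (z w : C) : cexp (z + w) = (cexp z * cexp w)%C.
Proof.
  unfold cexp. replace (Re (z + w)) with (Re z + Re w) by reflexivity.
  replace (Im (z + w)) with (Im z + Im w) by reflexivity.
  rewrite exp_plus, cis_plus, RtoC_mult. ring.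
Qed.

Lemma cexp_0 : cexp (RtoC 0) = RtoC 1.
Proof.
  unfold cexp, cis; simpl. rewrite exp_0, cos_0, sin_0.
  apply injective_projections; simpl; ring.
Qed.

Lemma is_derive_R_eps (f : R -> R) (x l : R) :
  is_derive f x l -> forall eps, 0 < eps -> exists d, 0 < d /\
  forall h, Rabs h < d -> Rabs (f (x + h) - f x - l * h) <= eps * Rabs h.
Proof.
  intros [_ H] eps He.
  specialize (H x (fun P HP => HP) (mkposreal eps He)).
  destruct H as [d Hd]. exists d. split; [apply cond_pos|].
  intros h Hh.
  assert (B : ball x d (x + h)).
  { change (Rabs (x + h - x) < d). replace (x + h - x) with h by ring. exact Hh. }
  specialize (Hd (x + h) B).
  change (Rabs (f (x + h) - f x - (x + h - x) * l) <= eps * Rabs (x + h - x)) in Hd.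
  replace (x + h - x) with h in Hd by ring. rewrite (Rmult_comm l). exact Hd.
Qed.

(** With [u], [s], [t] the first order errors of [exp], [cos] and [sin] at [0],
    the error of [cexp] at [(x, y)] is
    [u cis y + (1 + x) (s + i t) + i x y]. *)
Lemma is_derive_cexp_0 : is_derive cexp (RtoC 0) (RtoC 1).
Proof.
  apply is_derive_C_eps. intros eps He.
  assert (E8 : 0 < eps / 8) by lra.
  assert (D1 : is_derive exp 0 1).
  { auto_derive; [exact I|]. rewrite exp_0; ring. }
  assert (D2 : is_derive cos 0 0).
  { auto_derive; [exact I|]. rewrite sin_0; ring. }
  assert (D3 : is_derive sin 0 1).
  { auto_derive; [exact I|]. rewrite cos_0; ring. }
  destruct (is_derive_R_eps _ _ _ D1 _ E8) as [d1 [d10 H1]].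
  destruct (is_derive_R_eps _ _ _ D2 _ E8) as [d2 [d20 H2]].
  destruct (is_derive_R_eps _ _ _ D3 _ E8) as [d3 [d30 H3]].
  set (d4 := Rmin (Rmin d1 d2) (Rmin d3 (Rmin 1 (eps / 8)))).
  exists d4. split.
  { unfold d4. repeat apply Rmin_glb_lt; lra. }
  assert (d4 <= d1 /\ d4 <= d2 /\ d4 <= d3 /\ d4 <= 1 /\ d4 <= eps / 8) as [L1 [L2 [L3 [L4 L5]]]].
  { unfold d4.
    pose proof (Rmin_l (Rmin d1 d2) (Rmin d3 (Rmin 1 (eps / 8)))).
    pose proof (Rmin_r (Rmin d1 d2) (Rmin d3 (Rmin 1 (eps / 8)))).
    pose proof (Rmin_l d1 d2). pose proof (Rmin_r d1 d2).
    pose proof (Rmin_l d3 (Rmin 1 (eps / 8))). pose proof (Rmin_r d3 (Rmin 1 (eps / 8))).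
    pose proof (Rmin_l 1 (eps / 8)). pose proof (Rmin_r 1 (eps / 8)). lra. }
  intros [x y] Hw.
  replace ((x, y) - RtoC 0)%C with ((x, y) : C) in *
    by (apply injective_projections; simpl; ring).
  set (m := Cmod (x, y)) in *.
  assert (X : Rabs x <= m) by (eapply Rle_trans; [apply Rmax_l|exact (Rmax_Cmod (x, y))]).
  assert (Y : Rabs y <= m) by (eapply Rle_trans; [apply Rmax_r|exact (Rmax_Cmod (x, y))]).
  specialize (H1 x ltac:(lra)). specialize (H2 y ltac:(lra)). specialize (H3 y ltac:(lra)).
  rewrite Rplus_0_l in H1, H2, H3. rewrite exp_0 in H1. rewrite cos_0 in H2. rewrite sin_0 in H3.
  rewrite cexp_0.
  set (u := exp x - 1 - 1 * x) in *. set (s := cos y - 1 - 0 * y) in *.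
  set (t := sin y - 0 - 1 * y) in *.
  assert (M0 : 0 <= m) by apply Cmod_ge_0.
  replace (cexp (x, y) - RtoC 1 - RtoC 1 * (x, y))%C
    with (RtoC u * cis y + RtoC (1 + x) * (RtoC s + Ci * RtoC t) + RtoC x * (Ci * RtoC y))%C
    by (unfold cexp, cis, u, s, t; apply injective_projections; simpl; ring).
  eapply Rle_trans; [apply Cmod_triangle|].
  eapply Rle_trans; [apply Rplus_le_compat_r, Cmod_triangle|].
  rewrite !Cmod_mult, Cmod_cis, Cmod_Ci, !Cmod_R.
  assert (A1 : Rabs (1 + x) <= 2).
  { eapply Rle_trans; [apply Rabs_triang|]. rewrite Rabs_R1. lra. }
  assert (A2 : Cmod (RtoC s + Ci * RtoC t) <= Rabs s + Rabs t).
  { eapply Rle_trans; [apply Cmod_triangle|]. rewrite Cmod_mult, Cmod_Ci, !Cmod_R. lra. }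
  assert (U : Rabs u <= eps / 8 * m) by nra.
  assert (S : Rabs s <= eps / 8 * m) by nra.
  assert (T : Rabs t <= eps / 8 * m) by nra.
  assert (A3 : Rabs (1 + x) * Cmod (RtoC s + Ci * RtoC t) <= 2 * (Rabs s + Rabs t)).
  { apply Rmult_le_compat; [apply Rabs_pos|apply Cmod_ge_0|exact A1|exact A2]. }
  assert (A4 : Rabs x * (1 * Rabs y) <= eps / 8 * m).
  { rewrite Rmult_1_l. apply Rmult_le_compat; try apply Rabs_pos; lra. }
  nra.
Qed.

Lemma is_derive_cexp (z : C) : is_derive cexp z (cexp z).
Proof.
  apply is_derive_C_eps. intros eps He.
  set (k := Cmod (cexp z) + 1).
  assert (K0 : 0 < k) by (pose proof (Cmod_ge_0 (cexp z)); unfold k; lra).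
  destruct (proj1 (is_derive_C_eps _ _ _) is_derive_cexp_0 (eps / k)) as [d [d0 Hd]].
  { apply Rdiv_lt_0_compat; lra. }
  exists d. split; [exact d0|]. intros w Hw.
  specialize (Hd (w - z)%C).
  replace (w - z - RtoC 0)%C with (w - z)%C in Hd by ring.
  specialize (Hd Hw). rewrite cexp_0 in Hd.
  replace (cexp w - cexp z - cexp z * (w - z))%C
    with (cexp z * (cexp (w - z) - RtoC 1 - RtoC 1 * (w - z)))%C.
  2:{ replace (cexp w) with (cexp z * cexp (w - z))%C
        by (rewrite <- cexp_plus; f_equal; ring). ring. }
  rewrite Cmod_mult.
  eapply Rle_trans; [apply Rmult_le_compat_l; [apply Cmod_ge_0|exact Hd]|].
  rewrite <- Rmult_assoc. apply Rmult_le_compat_r; [apply Cmod_ge_0|].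
  apply Rle_trans with (k * (eps / k)); [|right; field; lra].
  apply Rmult_le_compat_r; [apply Rlt_le, Rdiv_lt_0_compat; lra | unfold k; lra].
Qed.

Definition circle_integral (F : C -> C) (r : R) : C :=
  CInt (fun t => F (RtoC r * cis t)%C) 0 (2 * PI).

Lemma Cmod_polar (r t : R) : 0 <= r -> Cmod (RtoC r * cis t) = r.
Proof. intros Hr. rewrite Cmod_mult, Cmod_cis, Cmod_R, Rabs_pos_eq; lra. Qed.

Lemma continuous_polar (r t : R) : continuous (fun t => RtoC r * cis t)%C t.
Proof.
  apply continuous_Cmult; [apply continuous_Cconst|].
  apply continuous_C_iff. split.
  - apply (ex_derive_continuous (V := R_NormedModule) cos). auto_derive. exact I.
  - apply (ex_derive_continuous (V := R_NormedModule) sin). auto_derive. exact I.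
Qed.

(** The circles of radii [r1] and [r2] are the images under [cexp] of the two
    vertical edges of a rectangle of height 2 pi, and the integrals along its
    horizontal edges cancel by periodicity. *)
Lemma circle_integral_annulus (F : C -> C) (r1 r2 : R) :
  0 < r1 -> r1 <= r2 ->
  (forall z, r1 <= Cmod z <= r2 -> @ex_derive C_AbsRing C_NormedModule F z) ->
  circle_integral F r1 = circle_integral F r2.
Proof.
  intros H1 H12 HF.
  assert (L : ln r1 <= ln r2) by (apply ln_le; assumption).
  pose proof PI_RGT_0 as Hpi.
  assert (Lr : forall x, ln r1 <= x <= ln r2 -> r1 <= exp x <= r2).
  { intros x [X1 X2].
    rewrite <- (exp_ln r1), <- (exp_ln r2) by lra. split.
    - destruct X1 as [X1|X1]; [left; apply exp_increasing, X1 | right; congruence].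
    - destruct X2 as [X2|X2]; [left; apply exp_increasing, X2 | right; congruence]. }
  assert (Gz : rect_integral (fun z => F (cexp z)) (ln r1) (ln r2) 0 (2 * PI) = RtoC 0).
  { apply goursat; [exact L|lra|]. intros x y Hx Hy.
    destruct (HF (cexp (x, y))) as [l Hl].
    { unfold cexp; simpl. rewrite Cmod_polar by (apply Rlt_le, exp_pos). apply Lr, Hx. }
    exists (cexp (x, y) * l)%C.
    apply is_derive_Ccomp; [exact Hl | apply is_derive_cexp]. }
  assert (V : forall r, 0 < r ->
    CInt (fun y => F (cexp (ln r, y))) 0 (2 * PI) = circle_integral F r).
  { intros r Hr. apply CInt_ext; [lra|]. intros t _.
    unfold cexp; simpl. rewrite exp_ln; auto. }
  unfold rect_integral in Gz.
  rewrite !V in Gz by lra.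
  assert (Hor : CInt (fun x => F (cexp (x, 2 * PI))) (ln r1) (ln r2) =
                CInt (fun x => F (cexp (x, 0))) (ln r1) (ln r2)).
  { apply CInt_ext; [exact L|]. intros x _. f_equal. unfold cexp, cis; simpl.
    rewrite cos_2PI, sin_2PI, cos_0, sin_0. reflexivity. }
  rewrite Hor in Gz.
  set (I1 := circle_integral F r1) in *. set (I2 := circle_integral F r2) in *.
  replace I1 with (I2 + Ci * (Ci * (I2 - I1)))%C.
  - replace (Ci * (I2 - I1))%C with (RtoC 0); [ring|].
    rewrite <- Gz. ring.
  - assert (Ci * Ci = - RtoC 1)%C
      by (apply injective_projections; simpl; ring).
    rewrite Cmult_assoc, H. ring.
Qed.

Lemma circle_integrand_continuous (F : C -> C) (r R0 : R) :
  0 <= r < R0 -> (forall z, Cmod z < R0 -> continuous F z) ->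
  continuous_on_itv (fun t => F (RtoC r * cis t)%C) 0 (2 * PI).
Proof.
  intros Hr HF t _.
  apply (continuous_comp (fun t => RtoC r * cis t)%C F); [apply continuous_polar|].
  apply HF. rewrite Cmod_polar; lra.
Qed.

(** By compactness, [(s, t) |-> F (s e^(i t))] is uniformly continuous near the
    segment [s = r], [0 <= t <= 2 pi]. *)
Lemma circle_integral_continuous (F : C -> C) (R0 r eps : R) :
  (forall z, Cmod z < R0 -> continuous F z) -> 0 <= r < R0 -> 0 < eps ->
  exists d, 0 < d /\ forall s, 0 <= s < R0 -> Rabs (s - r) < d ->
    Cmod (circle_integral F s - circle_integral F r) <= eps.
Proof.
  intros HF Hr He. pose proof PI_RGT_0 as Hpi.
  assert (C2 : forall (g : C -> R),
    (forall z, Cmod z < R0 -> continuous (fun w => g (F w)) z) ->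
    forall t, 0 <= t <= 2 * PI ->
    continuity_2d_pt (fun u v => g (F (RtoC u * cis v)%C)) r t).
  { intros g Hg t _. apply continuity_2d_pt_filterlim.
    apply (continuous_comp (U := C_UniformSpace)
      (fun z : R * R => RtoC (fst z) * cis (snd z))%C (fun w => g (F w)) (r, t)).
    - apply continuous_Cmult.
      + apply continuous_C_iff. split; [apply (continuous_fst r t)|apply continuous_const].
      + apply continuous_C_iff. split.
        * apply (continuous_comp (fun z : R * R => snd z) cos); [apply (continuous_snd r t)|].
          apply (ex_derive_continuous (V := R_NormedModule) cos). auto_derive. exact I.
        * apply (continuous_comp (fun z : R * R => snd z) sin); [apply (continuous_snd r t)|].
          apply (ex_derive_continuous (V := R_NormedModule) sin). auto_derive. exact I.
    - apply Hg. simpl. rewrite Cmod_polar; lra. }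
  set (e := eps / (4 * PI)).
  assert (E0 : 0 < e) by (apply Rdiv_lt_0_compat; lra).
  destruct (uniform_continuity_2d_1d' _ 0 (2 * PI) r
     (C2 Re (fun z Hz => proj1 (proj1 (continuous_C_iff F z) (HF z Hz))))
     (mkposreal e E0)) as [d1 H1].
  destruct (uniform_continuity_2d_1d' _ 0 (2 * PI) r
     (C2 Im (fun z Hz => proj2 (proj1 (continuous_C_iff F z) (HF z Hz))))
     (mkposreal e E0)) as [d2 H2].
  exists (Rmin d1 d2). split; [apply Rmin_glb_lt; apply cond_pos|].
  intros s Hs Hd.
  assert (D1 := Rlt_le_trans _ _ _ Hd (Rmin_l _ _)).
  assert (D2 := Rlt_le_trans _ _ _ Hd (Rmin_r _ _)).
  unfold circle_integral. rewrite <- CInt_minus;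
    [|lra|eapply circle_integrand_continuous; eassumption
         |eapply circle_integrand_continuous; eassumption].
  replace eps with (2 * e * (2 * PI - 0)) by (unfold e; field; lra).
  apply CInt_bound; [lra| |].
  - intros t Ht. apply continuous_Cminus;
      [eapply (circle_integrand_continuous F s) | eapply (circle_integrand_continuous F r)];
      eassumption.
  - intros t Ht.
    apply Rabs_def2 in D1. apply Rabs_def2 in D2.
    pose proof (cond_pos d1). pose proof (cond_pos d2).
    specialize (H1 t r t s Ht ltac:(lra) Ht ltac:(lra)).
    specialize (H2 t r t s Ht ltac:(lra) Ht ltac:(lra)).
    rewrite Rminus_diag, Rabs_R0 in H1, H2.
    specialize (H1 (cond_pos d1)). specialize (H2 (cond_pos d2)). simpl in H1, H2.
    set (u := F (RtoC s * cis t)%C) in *. set (v := F (RtoC r * cis t)%C) in *.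
    replace (u - v)%C with (RtoC (Re u - Re v) + Ci * RtoC (Im u - Im v))%C
      by (apply injective_projections; unfold Re, Im; simpl; ring).
    eapply Rle_trans; [apply Cmod_triangle|].
    rewrite Cmod_mult, !Cmod_R, Cmod_Ci. lra.
Qed.

(** The circle integral is locally constant in the radius except where the
    circle passes through the exceptional point [z1].  It depends continuously
    on the radius, so it is constant throughout, down to radius [0]. *)
Lemma circle_integral_mean_value (F : C -> C) (R0 r : R) (z1 : C) :
  (forall z, Cmod z < R0 -> continuous F z) ->
  (forall z, Cmod z < R0 -> z <> z1 -> @ex_derive C_AbsRing C_NormedModule F z) ->
  0 <= r < R0 ->
  circle_integral F r = (RtoC (2 * PI) * F (RtoC 0))%C.
Proof.
  intros HF HD Hr.
  assert (I0 : circle_integral F 0 = (RtoC (2 * PI) * F (RtoC 0))%C).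
  { unfold circle_integral.
    rewrite (CInt_ext _ (fun _ => F (RtoC 0))).
    - rewrite CInt_const, Rminus_0_r. reflexivity.
    - pose proof PI_RGT_0. lra.
    - intros t _. f_equal. apply Cmult_0_l. }
  assert (Lim : forall a L, 0 <= a < R0 ->
    (forall d, 0 < d -> exists s, 0 <= s < R0 /\ Rabs (s - a) < d /\ circle_integral F s = L) ->
    circle_integral F a = L).
  { intros a L Ha Hs.
    destruct (Req_dec (Cmod (L - circle_integral F a)) 0) as [E|E].
    - apply Cmod_eq_0 in E. replace L with (L - circle_integral F a + circle_integral F a)%C by ring.
      rewrite E. ring.
    - exfalso. pose proof (Cmod_ge_0 (L - circle_integral F a)) as G0.
      destruct (circle_integral_continuous F R0 a (Cmod (L - circle_integral F a) / 2) HF Ha)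
        as [d [d0 Hd]]; [lra|].
      destruct (Hs d d0) as [s [S1 [S2 S3]]].
      specialize (Hd s S1 S2). rewrite S3 in Hd. lra. }
  assert (Ann : forall s1 s2, 0 < s1 <= s2 -> s2 < R0 -> (Cmod z1 < s1 \/ s2 < Cmod z1) ->
    circle_integral F s1 = circle_integral F s2).
  { intros s1 s2 H12 H2 Hz. apply circle_integral_annulus; [lra|lra|].
    intros z Hz'. apply HD; [lra|]. intros ->. lra. }
  (* The exceptional radius is reached by a limit from below, and then serves
     as the limit from above for all larger radii. *)
  assert (Below : forall s, 0 <= s < R0 -> s < Cmod z1 -> circle_integral F s = circle_integral F 0).
  { intros s Hs Hsz. symmetry.
    destruct (Req_dec s 0) as [->|Hs0]; [reflexivity|].
    apply Lim; [lra|]. intros d Hd. exists (Rmin s (d / 2)).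
    assert (0 < Rmin s (d / 2)) by (apply Rmin_glb_lt; lra).
    pose proof (Rmin_l s (d / 2)). pose proof (Rmin_r s (d / 2)).
    split; [lra|]. split; [rewrite Rabs_pos_eq; lra|].
    apply Ann; lra. }
  assert (At : forall s, 0 <= s < R0 -> s = Cmod z1 -> circle_integral F s = circle_integral F 0).
  { intros s Hs Hsz.
    destruct (Req_dec s 0) as [->|Hs0]; [reflexivity|].
    apply Lim; [lra|]. intros d Hd. exists (Rmax 0 (s - d / 2)).
    assert (Rmax 0 (s - d / 2) < s) by (apply Rmax_lub_lt; lra).
    pose proof (Rmax_l 0 (s - d / 2)). pose proof (Rmax_r 0 (s - d / 2)).
    split; [lra|]. split; [rewrite Rabs_left; lra|].
    apply Below; lra. }
  rewrite <- I0.
  destruct (Rtotal_order r (Cmod z1)) as [H|[H|H]]; [apply Below; auto|apply At; auto|].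
  rewrite <- (At (Cmod z1)); [|pose proof (Cmod_ge_0 z1); lra|reflexivity].
  symmetry. pose proof (Cmod_ge_0 z1).
  apply Lim; [lra|]. intros d Hd. exists (Rmin r (Cmod z1 + d / 2)).
  assert (Cmod z1 < Rmin r (Cmod z1 + d / 2)) by (apply Rmin_glb_lt; lra).
  pose proof (Rmin_l r (Cmod z1 + d / 2)). pose proof (Rmin_r r (Cmod z1 + d / 2)).
  split; [lra|]. split; [rewrite Rabs_pos_eq; lra|].
  apply Ann; lra.
Qed.

(** * Cauchy's integral formula *)

Lemma continuous_on_itv_bounded (f : R -> C) (a b : R) :
  a <= b -> continuous_on_itv f a b ->
  exists M, 0 <= M /\ forall t, a <= t <= b -> Cmod (f t) <= M.
Proof.
  intros ab Hf.
  destruct (continuous_on_ex_RInt f a b ab Hf) as [[l1 F1] [l2 F2]].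
  destruct (ex_RInt_ub (V := C_R_NormedModule) f a b) as [M HM].
  { exists ((l1, l2) : C).
    apply (is_RInt_fct_extend_pair (U := R_NormedModule) (V := R_NormedModule)); assumption. }
  rewrite Rmin_left, Rmax_right in HM by exact ab.
  exists M. split.
  - eapply Rle_trans; [apply (Cmod_ge_0 (f a))|]. rewrite Cmod_norm. apply HM. lra.
  - intros t Ht. rewrite Cmod_norm. apply HM, Ht.
Qed.

Lemma polar_minus_neq_0 (r t : R) (w : C) :
  Cmod w < r -> (RtoC r * cis t - w)%C <> RtoC 0.
Proof.
  intros Hw H. pose proof (Cmod_ge_0 w).
  assert (E : (RtoC r * cis t)%C = w)
    by (rewrite <- (Cplus_0_r w), <- H; ring).
  apply (f_equal Cmod) in E. rewrite Cmod_polar in E; lra.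
Qed.

Lemma Cmod_polar_minus (r t : R) (w : C) :
  0 <= r -> r - Cmod w <= Cmod (RtoC r * cis t - w).
Proof.
  intros Hr. rewrite <- (Cmod_polar r t Hr) at 1.
  pose proof (Cmod_triangle (RtoC r * cis t - w) w) as H.
  replace (RtoC r * cis t - w + w)%C with (RtoC r * cis t)%C in H by ring. lra.
Qed.

(** On the circle the conjugate of [z / (z - w)] coincides with
    [r^2 / (r^2 - conj w * z)], which is holomorphic on a larger disc. *)
Lemma cauchy_kernel_integral (r : R) (w : C) :
  Cmod w < r ->
  circle_integral (fun z => z / (z - w))%C r = RtoC (2 * PI).
Proof.
  intros Hw. pose proof (Cmod_ge_0 w) as W0.
  set (g := fun z : C => (RtoC (r * r) * / (RtoC (r * r) - Cconj w * z))%C).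
  (* Chosen with [r < R0] and [R0 * Cmod w < r * r]. *)
  set (R0 := 2 * (r * r) / (r + Cmod w)).
  assert (D0 : 0 < r + Cmod w) by lra.
  assert (HR : r < R0).
  { unfold R0. apply Rlt_div_r; [lra|]. nra. }
  assert (Hg : forall z, Cmod z < R0 -> @ex_derive C_AbsRing C_NormedModule g z).
  { intros z Hz.
    assert (N : (RtoC (r * r) - Cconj w * z)%C <> RtoC 0).
    { intros E.
      assert (E' : RtoC (r * r) = (Cconj w * z)%C)
        by (rewrite <- (Cplus_0_r (Cconj w * z)), <- E; ring).
      apply (f_equal Cmod) in E'.
      rewrite Cmod_R, Rabs_pos_eq, Cmod_mult, Cmod_conj in E' by nra.
      assert (Cmod w * Cmod z <= Cmod w * R0) by (apply Rmult_le_compat_l; lra).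
      assert (Cmod w * R0 < r * r).
      { unfold R0. replace (Cmod w * (2 * (r * r) / (r + Cmod w)))
          with (r * r * (2 * Cmod w) / (r + Cmod w)) by (field; lra).
        apply Rlt_div_l; [lra|]. apply Rmult_lt_compat_l; nra. }
      lra. }
    eexists. unfold g. apply is_derive_Cmult; [apply is_derive_Cconst|].
    apply (is_derive_Ccomp Cinv); [apply is_derive_Cinv, N|].
    apply is_derive_Cminus; [apply is_derive_Cconst|].
    apply is_derive_Cmult; [apply is_derive_Cconst|apply is_derive_Cid]. }
  assert (Hc : forall z, Cmod z < R0 -> continuous g z)
    by (intros z Hz; apply ex_derive_continuous_C, Hg, Hz).
  pose proof (circle_integral_mean_value g R0 r (RtoC 0) Hc (fun z Hz _ => Hg z Hz)
               ltac:(lra)) as E.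
  replace (g (RtoC 0)) with (RtoC 1) in E.
  2:{ unfold g. field. intros K. apply RtoC_inj in K. nra. }
  pose proof PI_RGT_0 as Hpi.
  transitivity (Cconj (circle_integral g r)).
  - unfold circle_integral. rewrite <- CInt_conj;
      [|lra|apply (circle_integrand_continuous g r R0); [lra|exact Hc]].
    apply CInt_ext; [lra|]. intros t _. unfold g.
    pose proof (polar_minus_neq_0 r t w Hw) as N1.
    assert (Zn : (RtoC r * cis t)%C <> RtoC 0).
    { pose proof (polar_minus_neq_0 r t (RtoC 0)) as N0.
      rewrite Cmod_0 in N0. intros K. apply N0; [lra|]. rewrite K. ring. }
    assert (Sq : (RtoC (r * r))%C = (RtoC r * cis t * Cconj (RtoC r * cis t))%C).
    { rewrite <- Cmod2_conj, Cmod_polar by lra. apply f_equal. simpl. ring. }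
    assert (Rc : Cconj (RtoC (r * r)) = RtoC (r * r))
      by (apply injective_projections; simpl; ring).
    set (z := (RtoC r * cis t)%C) in *.
    assert (Zc : Cconj z <> RtoC 0).
    { intros K. apply Zn. rewrite <- (Cconj_conj z), K.
      apply injective_projections; simpl; ring. }
    assert (N3 : (RtoC (r * r) - Cconj w * z)%C <> RtoC 0).
    { rewrite Sq. replace (z * Cconj z - Cconj w * z)%C with (z * Cconj (z - w))%C
        by (rewrite Cminus_conj; ring).
      apply Cmult_neq_0; [exact Zn|]. intros K. apply N1.
      rewrite <- (Cconj_conj (z - w)), K. apply injective_projections; simpl; ring. }
    rewrite Cmult_conj, Cinv_conj, Cminus_conj, Cmult_conj, Cconj_conj, Rc, Sq by exact N3.
    field. split; [|exact N1].
    replace (z * Cconj z - w * Cconj z)%C with (Cconj z * (z - w))%C by ring.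
    apply Cmult_neq_0; assumption.
  - rewrite E. apply injective_projections; simpl; ring.
Qed.

Lemma cauchy_kernel_continuous (r : R) (n : nat) (w : C) :
  Cmod w < r ->
  forall t, continuous (fun t => / (RtoC r * cis t - w) ^ n)%C t.
Proof.
  intros Hw t. apply continuous_Cinv.
  - apply continuous_Cpow, continuous_Cminus; [apply continuous_polar|apply continuous_Cconst].
  - apply Cpow_nz, polar_minus_neq_0, Hw.
Qed.

(** The mean value property of [z * q z], where [q] is the difference quotient
    [(f z - f w) / (z - w)] completed by [f' w] at [w]: this function is
    continuous, holomorphic off [w], and vanishes at [0].  What remains is the
    integral of the Cauchy kernel. *)
Theorem cauchy_formula (f : C -> C) (R0 r : R) (w : C) :
  (forall z, Cmod z < R0 -> @ex_derive C_AbsRing C_NormedModule f z) ->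
  r < R0 -> Cmod w < r ->
  CInt (fun t => f (RtoC r * cis t)%C * (RtoC r * cis t) * / (RtoC r * cis t - w))%C
    0 (2 * PI) = (RtoC (2 * PI) * f w)%C.
Proof.
  intros Hf Hr Hw. pose proof (Cmod_ge_0 w) as W0. pose proof PI_RGT_0 as Hpi.
  destruct (Hf w ltac:(lra)) as [l Hl].
  set (q := fun z : C => if Ceq_dec z w then (l : C) else ((f z - f w) * / (z - w))%C).
  assert (Hq : forall z, z <> w -> q z = ((f z - f w) * / (z - w))%C).
  { intros z Hz. unfold q. destruct (Ceq_dec z w); [contradiction|reflexivity]. }
  assert (Dq : forall z, Cmod z < R0 -> z <> w -> @ex_derive C_AbsRing C_NormedModule q z).
  { intros z Hz Hzw. destruct (Hf z Hz) as [l' Hl']. eexists.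
    eapply is_derive_ext_loc with (f := fun z => ((f z - f w) * / (z - w))%C).
    - apply (proj1 (locally_C z _)), locally_C_eps.
      exists (Cmod (w - z)). split.
      + apply Cmod_gt_0. intros K. apply Hzw. symmetry. apply Ceq_minus, K.
      + intros v Hv. symmetry. apply Hq. intros ->. lra.
    - apply is_derive_Cmult.
      + apply is_derive_Cminus; [exact Hl'|apply is_derive_Cconst].
      + apply (is_derive_Ccomp Cinv (fun z => z - w)%C).
        * apply is_derive_Cinv. intros K. apply Hzw, Ceq_minus, K.
        * apply is_derive_Cminus; [apply is_derive_Cid|apply is_derive_Cconst]. }
  assert (Cq : forall z, Cmod z < R0 -> continuous q z).
  { intros z Hz. destruct (Ceq_dec z w) as [->|Hzw];
      [|apply ex_derive_continuous_C, Dq; assumption].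
    apply continuous_C_eps. intros eps He. apply locally_C_eps.
    destruct (proj1 (is_derive_C_eps f w l) Hl (eps / 2) ltac:(lra)) as [d [d0 Hd]].
    exists d. split; [exact d0|]. intros v Hv.
    assert (qw : q w = l) by (unfold q; destruct (Ceq_dec w w); [reflexivity|contradiction]).
    rewrite qw. destruct (Ceq_dec v w) as [->|Hvw].
    - rewrite qw. replace (l - l)%C with (RtoC 0) by ring. rewrite Cmod_0. exact He.
    - assert (N : (v - w)%C <> RtoC 0) by (intros K; apply Hvw, Ceq_minus, K).
      rewrite (Hq v Hvw).
      replace ((f v - f w) * / (v - w) - l)%C with ((f v - f w - l * (v - w)) / (v - w))%C
        by (field; exact N).
      rewrite Cmod_div by exact N.
      apply Rle_lt_trans with (eps / 2); [|lra].
      apply Rle_div_l; [apply Cmod_gt_0, N|]. apply Hd, Hv. }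
  assert (E' : circle_integral (fun z => z * q z)%C r = (RtoC (2 * PI) * (RtoC 0 * q (RtoC 0)))%C).
  { apply (circle_integral_mean_value (fun z => z * q z)%C R0 r w); [| |lra].
    - intros z Hz. apply continuous_Cmult; [apply continuous_id|apply Cq, Hz].
    - intros z Hz Hzw. destruct (Dq z Hz Hzw) as [l' Hl']. eexists.
      apply is_derive_Cmult; [apply is_derive_Cid|exact Hl']. }
  rewrite Cmult_0_l, Cmult_0_r in E'.
  assert (fc : continuous_on_itv (fun t => f (RtoC r * cis t)%C) 0 (2 * PI)).
  { apply (circle_integrand_continuous f r R0); [lra|].
    intros z Hz. apply ex_derive_continuous_C, Hf, Hz. }
  assert (kc : continuous_on_itv
    (fun t => (RtoC r * cis t) / (RtoC r * cis t - w))%C 0 (2 * PI)).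
  { intros t _. apply continuous_Cmult; [apply continuous_polar|].
    apply continuous_Cinv; [|apply polar_minus_neq_0, Hw].
    apply continuous_Cminus; [apply continuous_polar|apply continuous_Cconst]. }
  unfold circle_integral in E'.
  rewrite (CInt_ext _ (fun t => f (RtoC r * cis t)%C * (RtoC r * cis t) * / (RtoC r * cis t - w)
      - f w * ((RtoC r * cis t) / (RtoC r * cis t - w)))%C) in E'; [|lra|].
  2:{ intros t _. pose proof (polar_minus_neq_0 r t w Hw) as N.
      rewrite Hq; [field; exact N|]. intros K. apply N. rewrite K. ring. }
  rewrite CInt_minus in E'; [|lra| |].
  - rewrite CInt_scal in E' by (try lra; exact kc).
    pose proof (cauchy_kernel_integral r w Hw) as Ek. unfold circle_integral in Ek.
    rewrite Ek in E'. apply Ceq_minus. rewrite <- E'. ring.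
  - intros t Ht.
    apply (continuous_ext (fun t => f (RtoC r * cis t)%C * ((RtoC r * cis t) / (RtoC r * cis t - w)))%C).
    + intros s. unfold Cdiv. apply Cmult_assoc.
    + apply continuous_Cmult; [apply fc, Ht|apply kc, Ht].
  - intros t Ht. apply continuous_Cmult; [apply continuous_Cconst|apply kc, Ht].
Qed.

(** * Cauchy-type integrals *)

Definition cauchy_type (phi : R -> C) (r : R) (n : nat) (w : C) : C :=
  CInt (fun t => phi t * / (RtoC r * cis t - w) ^ S n)%C 0 (2 * PI).

(** For [u = 1 / (z - w')], [v = 1 / (z - w)] and [h = w' - w] this is the second
    order error of [w |-> (z - w)^(-n)], bounded uniformly in [z].  With [E_n]
    the error, [E_(n+1) = u E_n + (n + 1) v^(n+2) u h^2]. *)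
Lemma power_difference_bound (k : R) (n : nat) :
  0 <= k -> exists B, 0 <= B /\ forall u v h : C,
    Cmod u <= k -> Cmod v <= k -> (u - v)%C = (h * u * v)%C ->
    Cmod (u ^ n - v ^ n - RtoC (INR n) * v ^ S n * h) <= B * Cmod h ^ 2.
Proof.
  intros Hk. induction n as [|n [B [B0 IH]]].
  - exists 0. split; [lra|]. intros u v h _ _ _.
    replace (u ^ 0 - v ^ 0 - RtoC (INR 0) * v ^ 1 * h)%C with (RtoC 0) by (simpl; ring).
    rewrite Cmod_0. lra.
  - exists (k * B + INR (S n) * k ^ S (S (S n))). split.
    { apply Rplus_le_le_0_compat; [apply Rmult_le_pos; lra|].
      apply Rmult_le_pos; [apply pos_INR|apply pow_le, Hk]. }
    intros u v h Hu Hv E. specialize (IH u v h Hu Hv E).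
    replace (u ^ S n - v ^ S n - RtoC (INR (S n)) * v ^ S (S n) * h)%C
      with (u * (u ^ n - v ^ n - RtoC (INR n) * v ^ S n * h)
            + RtoC (INR (S n)) * (v ^ S (S n) * u) * (h * h))%C.
    2:{ rewrite S_INR, RtoC_plus, !Cpow_S.
        apply Ceq_minus.
        transitivity (v ^ n * (RtoC 1 + (RtoC (INR n) + RtoC 1) * v * h)
                      * (h * u * v - (u - v)))%C; [ring|].
        rewrite E. ring. }
    eapply Rle_trans; [apply Cmod_triangle|].
    rewrite !Cmod_mult, !Cmod_pow, Cmod_R, Rabs_pos_eq by apply pos_INR.
    rewrite Rmult_plus_distr_r. apply Rplus_le_compat.
    + rewrite Rmult_assoc. apply Rmult_le_compat; try apply Cmod_ge_0; assumption.
    + replace (Cmod h ^ 2) with (Cmod h * Cmod h) by ring.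
      apply Rmult_le_compat_r; [apply Rmult_le_pos; apply Cmod_ge_0|].
      apply Rmult_le_compat_l; [apply pos_INR|].
      replace (k ^ S (S (S n))) with (k ^ S (S n) * k) by (simpl; ring).
      apply Rmult_le_compat; try apply Cmod_ge_0; [apply pow_le, Cmod_ge_0| |exact Hu].
      apply pow_incr. split; [apply Cmod_ge_0|exact Hv].
Qed.

(** Differentiation under the integral sign: at points within [rho] of [w], half
    the distance from [w] to the circle, all kernels are at most [1 / rho], and
    the error of the kernel is quadratic uniformly on the circle. *)
Lemma is_derive_cauchy_type (phi : R -> C) (r : R) (n : nat) (w : C) :
  continuous_on_itv phi 0 (2 * PI) -> Cmod w < r ->
  is_derive (cauchy_type phi r n) w
    (RtoC (INR (S n)) * cauchy_type phi r (S n) w)%C.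
Proof.
  intros Hphi Hw. pose proof (Cmod_ge_0 w) as W0. pose proof PI_RGT_0 as Hpi.
  assert (Hpi2 : 0 <= 2 * PI) by lra.
  destruct (continuous_on_itv_bounded phi 0 (2 * PI) Hpi2 Hphi) as [M [M0 HM]].
  set (rho := (r - Cmod w) / 2).
  assert (rho0 : 0 < rho) by (unfold rho; lra).
  destruct (power_difference_bound (/ rho) (S n)) as [B [B0 HB]].
  { apply Rlt_le, Rinv_0_lt_compat, rho0. }
  apply is_derive_C_eps. intros eps He.
  set (D := M * B * (2 * PI)).
  assert (D0 : 0 <= D) by (exact (Rmult_le_pos _ _ (Rmult_le_pos _ _ M0 B0) Hpi2)).
  exists (Rmin rho (eps / (D + 1))). split.
  { apply Rmin_glb_lt; [exact rho0|]. apply Rdiv_lt_0_compat; lra. }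
  intros w' Hw'.
  assert (H1 := Rlt_le_trans _ _ _ Hw' (Rmin_l _ _)).
  assert (H2 := Rlt_le_trans _ _ _ Hw' (Rmin_r _ _)).
  set (h := (w' - w)%C) in *.
  assert (W' : Cmod w' <= Cmod w + Cmod h).
  { replace w' with (w + h)%C by (unfold h; ring). apply Cmod_triangle. }
  assert (W'r : Cmod w' < r) by (unfold rho in H1; lra).
  assert (Kc : forall m v, Cmod v < r ->
    continuous_on_itv (fun t => phi t * / (RtoC r * cis t - v) ^ m)%C 0 (2 * PI)).
  { intros m v Hv t Ht. apply continuous_Cmult; [apply Hphi, Ht|].
    apply cauchy_kernel_continuous, Hv. }
  unfold cauchy_type.
  replace (RtoC (INR (S n)) * CInt (fun t => phi t * / (RtoC r * cis t - w) ^ S (S n)) 0 (2 * PI) * h)%C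
    with (CInt (fun t => (RtoC (INR (S n)) * h) * (phi t * / (RtoC r * cis t - w) ^ S (S n)))%C 0 (2 * PI)).
  2:{ rewrite CInt_scal; [ring|lra|apply Kc, Hw]. }
  rewrite <- !CInt_minus.
  - apply Rle_trans with (M * (B * Cmod h ^ 2) * (2 * PI - 0)).
    + apply CInt_bound; [lra| |].
      * intros t Ht. apply continuous_Cminus; [apply continuous_Cminus|].
        -- apply (Kc (S n) w' W'r), Ht.
        -- apply (Kc (S n) w Hw), Ht.
        -- apply continuous_Cmult; [apply continuous_Cconst|apply (Kc (S (S n)) w Hw), Ht].
      * intros t Ht.
        set (u := (/ (RtoC r * cis t - w'))%C).
        set (v := (/ (RtoC r * cis t - w))%C).
        pose proof (polar_minus_neq_0 r t w Hw) as Nw.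
        pose proof (polar_minus_neq_0 r t w' W'r) as Nw'.
        rewrite <- !Cpow_inv by assumption. fold u v.
        replace (phi t * u ^ S n - phi t * v ^ S n
                 - RtoC (INR (S n)) * h * (phi t * v ^ S (S n)))%C
          with (phi t * (u ^ S n - v ^ S n - RtoC (INR (S n)) * v ^ S (S n) * h))%C by ring.
        rewrite Cmod_mult. apply Rmult_le_compat; try apply Cmod_ge_0; [apply HM, Ht|].
        apply HB.
        -- unfold u. rewrite Cmod_inv by exact Nw'. apply Rinv_le_contravar; [exact rho0|].
           eapply Rle_trans; [|apply Cmod_polar_minus; lra]. unfold rho in *. lra.
        -- unfold v. rewrite Cmod_inv by exact Nw. apply Rinv_le_contravar; [exact rho0|].
           eapply Rle_trans; [|apply Cmod_polar_minus; lra]. unfold rho in *. lra.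
        -- unfold u, v, h. field. split; assumption.
    + replace (M * (B * Cmod h ^ 2) * (2 * PI - 0)) with (D * Cmod h * Cmod h)
        by (unfold D; ring).
      apply Rmult_le_compat_r; [apply Cmod_ge_0|].
      apply Rlt_div_r in H2; [|lra].
      pose proof (Cmod_ge_0 h). nra.
  - lra.
  - intros t Ht. apply continuous_Cminus; [apply (Kc (S n) w' W'r), Ht|apply (Kc (S n) w Hw), Ht].
  - intros t Ht. apply continuous_Cmult; [apply continuous_Cconst|apply (Kc (S (S n)) w Hw), Ht].
  - lra.
  - apply Kc, W'r.
  - apply Kc, Hw.
Qed.

(** * Taylor expansion *)

Lemma RtoC_neq_0 (x : R) : x <> 0 -> RtoC x <> RtoC 0.
Proof. intros Hx K. apply Hx, RtoC_inj, K. Qed.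

(** The density for which [cauchy_type] represents [2 pi p]: the factor
    [r e^(i t)] comes from [dz = i r e^(i t) dt] in Cauchy's formula. *)
Definition boundary_density (p : C -> C) (z0 : C) (r t : R) : C :=
  (p (z0 + RtoC r * cis t) * (RtoC r * cis t))%C.

Lemma is_derive_translate (f : C -> C) (z0 z l : C) :
  is_derive f (z0 + z)%C l -> is_derive (fun z => f (z0 + z)%C) z l.
Proof.
  intros H. rewrite <- (Cmult_1_l l).
  apply (is_derive_Ccomp f (fun z => z0 + z)%C); [exact H|].
  rewrite <- (Cplus_0_l (RtoC 1)).
  apply is_derive_Cplus; [apply is_derive_Cconst|apply is_derive_Cid].
Qed.

Lemma boundary_density_continuous (p : C -> C) (z0 : C) (R0 r : R) :
  (forall z, Cmod (z - z0) < R0 -> @ex_derive C_AbsRing C_NormedModule p z) ->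
  0 < r < R0 -> continuous_on_itv (boundary_density p z0 r) 0 (2 * PI).
Proof.
  intros Hp Hr t Ht. unfold boundary_density.
  apply continuous_Cmult; [|apply continuous_polar].
  apply (continuous_comp (fun t => z0 + RtoC r * cis t)%C p).
  - apply continuous_Cplus; [apply continuous_Cconst|apply continuous_polar].
  - apply ex_derive_continuous_C, Hp.
    replace (z0 + RtoC r * cis t - z0)%C with (RtoC r * cis t)%C by ring.
    rewrite Cmod_polar; lra.
Qed.

(** By induction on the order from Cauchy's formula; it has to be stated on the
    whole disc, as each derivative depends on the previous one at nearby
    points. *)
Lemma C_derive_n_cauchy (p : C -> C) (z0 : C) (R0 r : R) :
  (forall z, Cmod (z - z0) < R0 -> @ex_derive C_AbsRing C_NormedModule p z) ->
  0 < r < R0 ->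
  forall (n : nat) (z : C), Cmod (z - z0) < r ->
    C_derive_n p n z =
    (RtoC (INR (fact n) / (2 * PI)) *
     cauchy_type (boundary_density p z0 r) r n (z - z0))%C.
Proof.
  intros Hp Hr. pose proof PI_RGT_0 as Hpi.
  assert (P2 : RtoC (2 * PI) <> RtoC 0) by (apply RtoC_neq_0; lra).
  induction n as [|n IH]; intros z Hz.
  - pose proof (cauchy_formula (fun z => p (z0 + z)%C) R0 r (z - z0)) as E.
    cbv beta in E. replace (z0 + (z - z0))%C with z in E by ring.
    unfold cauchy_type, boundary_density.
    rewrite (CInt_ext _ (fun t => p (z0 + RtoC r * cis t) * (RtoC r * cis t)
                            * / (RtoC r * cis t - (z - z0)))%C); [|lra|].
    + rewrite E; [|clear E|lra|exact Hz].
      * rewrite RtoC_div by lra. change (INR (fact 0)) with 1.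
        change (C_derive_n p 0 z) with (p z). field. exact P2.
      * intros v Hv. destruct (Hp (z0 + v)%C) as [l Hl].
        { replace (z0 + v - z0)%C with v by ring. exact Hv. }
        exists l. apply is_derive_translate, Hl.
    + intros t _. rewrite Cpow_1_r. reflexivity.
  - change (C_derive_n p (S n) z) with (C_derive (C_derive_n p n) z).
    apply is_C_derive_unique.
    apply is_derive_ext_loc with
      (f := (fun z => RtoC (INR (fact n) / (2 * PI)) *
               cauchy_type (boundary_density p z0 r) r n (z - z0))%C).
    { apply (proj1 (locally_C z _)), locally_C_eps.
      exists (r - Cmod (z - z0)). split; [lra|]. intros w Hw. symmetry. apply IH.
      replace (w - z0)%C with ((w - z) + (z - z0))%C by ring.
      eapply Rle_lt_trans; [apply Cmod_triangle|]. lra. }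
    assert (D : is_derive (fun z => cauchy_type (boundary_density p z0 r) r n (z - z0)%C) z
       (RtoC (INR (S n)) * cauchy_type (boundary_density p z0 r) r (S n) (z - z0))%C).
    { rewrite <- (Cmult_1_l (RtoC (INR (S n)) * _)%C).
      apply (is_derive_Ccomp _ (fun z => z - z0)%C).
      - apply is_derive_cauchy_type; [|exact Hz].
        eapply boundary_density_continuous; eassumption.
      - replace (RtoC 1) with (RtoC 1 - RtoC 0)%C by ring.
        apply is_derive_Cminus; [apply is_derive_Cid|apply is_derive_Cconst]. }
    replace (RtoC (INR (fact (S n)) / (2 * PI)) *
             cauchy_type (boundary_density p z0 r) r (S n) (z - z0))%C
      with (RtoC 0 * cauchy_type (boundary_density p z0 r) r n (z - z0)
            + RtoC (INR (fact n) / (2 * PI)) *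
              (RtoC (INR (S n)) * cauchy_type (boundary_density p z0 r) r (S n) (z - z0)))%C.
    + exact (is_derive_Cmult _ _ _ _ _
               (is_derive_Cconst (RtoC (INR (fact n) / (2 * PI))) z) D).
    + rewrite !RtoC_div by lra. rewrite fact_simpl, mult_INR, (RtoC_mult (INR (S n))).
      field. exact P2.
Qed.

(** With [z = r e^(i t)], this is what is left of the integral of
    [phi / (z - w)] after [n] terms of the geometric expansion of [1 / (z - w)]
    in powers of [w / z], divided by [w^n]. *)
Definition taylor_remainder (phi : R -> C) (r : R) (n : nat) (w : C) : C :=
  CInt (fun t => phi t * / (RtoC r * cis t) ^ n * / (RtoC r * cis t - w))%C 0 (2 * PI).

Lemma polar_neq_0 (r t : R) : 0 < r -> (RtoC r * cis t)%C <> RtoC 0.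
Proof.
  intros Hr K. apply (f_equal Cmod) in K. rewrite Cmod_polar, Cmod_0 in K; lra.
Qed.

Lemma taylor_remainder_continuous (phi : R -> C) (r : R) (n : nat) (w : C) :
  continuous_on_itv phi 0 (2 * PI) -> 0 < r -> Cmod w < r ->
  continuous_on_itv
    (fun t => phi t * / (RtoC r * cis t) ^ n * / (RtoC r * cis t - w))%C 0 (2 * PI).
Proof.
  intros Hphi Hr Hw t Ht. apply continuous_Cmult; [apply continuous_Cmult|].
  - apply Hphi, Ht.
  - apply continuous_Cinv; [apply continuous_Cpow, continuous_polar|].
    apply Cpow_nz, polar_neq_0, Hr.
  - apply continuous_Cinv; [|apply polar_minus_neq_0, Hw].
    apply continuous_Cminus; [apply continuous_polar|apply continuous_Cconst].
Qed.

(** One term of the geometric expansion: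
    [z^(-n) / (z - w) = z^(-n-1) + w z^(-n-1) / (z - w)]. *)
Lemma taylor_remainder_step (phi : R -> C) (r : R) (n : nat) (w : C) :
  continuous_on_itv phi 0 (2 * PI) -> 0 < r -> Cmod w < r ->
  taylor_remainder phi r n w =
  (cauchy_type phi r n (RtoC 0) + w * taylor_remainder phi r (S n) w)%C.
Proof.
  intros Hphi Hr Hw. pose proof PI_RGT_0 as Hpi.
  unfold taylor_remainder at 2.
  rewrite <- CInt_scal; [|lra|apply taylor_remainder_continuous; assumption].
  unfold cauchy_type. rewrite <- CInt_plus; [|lra| |].
  - apply CInt_ext; [lra|]. intros t _. rewrite !Cpow_S.
    replace (RtoC r * cis t - RtoC 0)%C with (RtoC r * cis t)%C by ring.
    pose proof (polar_neq_0 r t Hr) as N0.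
    pose proof (polar_minus_neq_0 r t w Hw) as N1.
    pose proof (Cpow_nz _ n N0) as N2.
    set (z := (RtoC r * cis t)%C) in *. set (zn := (z ^ n)%C) in *.
    field. auto.
  - intros t Ht. apply continuous_Cmult; [apply Hphi, Ht|].
    apply cauchy_kernel_continuous. rewrite Cmod_0. exact Hr.
  - intros t Ht. apply continuous_Cmult; [apply continuous_Cconst|].
    apply (taylor_remainder_continuous phi r (S n) w); assumption.
Qed.

Lemma taylor_remainder_bound (phi : R -> C) (r M : R) (n : nat) (w : C) :
  continuous_on_itv phi 0 (2 * PI) -> 0 < r -> Cmod w <= r / 2 -> 0 <= M ->
  (forall t, 0 <= t <= 2 * PI -> Cmod (phi t) <= M) ->
  Cmod (taylor_remainder phi r n w) <= 4 * PI * M / r * / r ^ n.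
Proof.
  intros Hphi Hr Hw M0 HM. pose proof PI_RGT_0 as Hpi.
  assert (Pn : 0 < r ^ n) by (apply pow_lt, Hr).
  apply Rle_trans with (M * / r ^ n * (2 / r) * (2 * PI - 0)).
  - apply CInt_bound; [lra|apply taylor_remainder_continuous; try assumption; lra|].
    intros t Ht.
    assert (Hw' : Cmod w < r) by lra.
    pose proof (polar_minus_neq_0 r t w Hw') as N1.
    rewrite !Cmod_mult, !Cmod_inv, Cmod_pow, Cmod_polar; try lra; try exact N1.
    2:{ apply Cpow_nz, polar_neq_0, Hr. }
    apply Rmult_le_compat.
    + apply Rmult_le_pos; [apply Cmod_ge_0|apply Rlt_le, Rinv_0_lt_compat, Pn].
    + apply Rlt_le, Rinv_0_lt_compat, Cmod_gt_0, N1.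
    + apply Rmult_le_compat_r; [apply Rlt_le, Rinv_0_lt_compat, Pn|apply HM, Ht].
    + replace (2 / r) with (/ (r / 2)) by (field; lra).
      apply Rinv_le_contravar; [lra|].
      eapply Rle_trans; [|apply Cmod_polar_minus; lra]. lra.
  - right. field. lra.
Qed.

Lemma taylor_expansion_vanishing (phi : R -> C) (r : R) (w : C) (n : nat) :
  continuous_on_itv phi 0 (2 * PI) -> 0 < r -> Cmod w < r ->
  (forall i, (1 <= i <= n)%nat -> cauchy_type phi r i (RtoC 0) = RtoC 0) ->
  taylor_remainder phi r 0 w =
  (cauchy_type phi r 0 (RtoC 0) + w ^ S n * taylor_remainder phi r (S n) w)%C.
Proof.
  intros Hphi Hr Hw. induction n as [|n IH]; intros H0.
  - rewrite taylor_remainder_step, Cpow_1_r by assumption. reflexivity.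
  - rewrite IH by (intros i Hi; apply H0; lia).
    rewrite (taylor_remainder_step phi r (S n)), (H0 (S n)) by (assumption || lia).
    rewrite (Cpow_S w (S n)). ring.
Qed.

(** If some derivative of order at least one is nonzero, the first such order
    gives the leading term, and the next remainder, which is bounded, gives the
    error.  If all of them vanish, [2 pi (p z - p z0)] equals [w^n] times the
    [n]-th remainder for every [n >= 1], where [w = z - z0]; for [Cmod w < r / 2] this is [O(2^(-n))], so
    [p] is constant. *)
Theorem holomorphic_leading_term (p : C -> C) (z0 : C) :
  holomorphic_near p z0 ->
  constant_near p z0 \/
  exists (k : nat) (M d : R), first_nonzero_derivative p z0 k /\ 0 <= M /\ 0 < d /\
    forall w, Cmod w < d ->
      Cmod (p (z0 + w)%C - p z0 - C_derive_n p k z0 / RtoC (INR (fact k)) * w ^ k)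
      <= M * Cmod w ^ S k.
Proof.
  intros Hp. pose proof PI_RGT_0 as Hpi. unfold holomorphic_near in Hp.
  apply locally_C_eps in Hp. destruct Hp as [R0 [HR0 Hp]].
  set (r := R0 / 2). assert (Hr : 0 < r < R0) by (unfold r; lra).
  set (phi := boundary_density p z0 r).
  assert (Hphi : continuous_on_itv phi 0 (2 * PI))
    by (eapply boundary_density_continuous; eassumption).
  assert (Hpi2 : 0 <= 2 * PI) by lra.
  destruct (continuous_on_itv_bounded phi 0 (2 * PI) Hpi2 Hphi) as [M [M0 HM]].
  pose proof (C_derive_n_cauchy p z0 R0 r Hp Hr) as HC. fold phi in HC.
  assert (P2 : RtoC (2 * PI) <> RtoC 0) by (apply RtoC_neq_0; lra).
  assert (Hc : forall n, cauchy_type phi r n (RtoC 0) =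
    (RtoC (2 * PI) * (C_derive_n p n z0 / RtoC (INR (fact n))))%C).
  { intros n. rewrite HC; replace (z0 - z0)%C with (RtoC 0) by ring;
      [|rewrite Cmod_0; lra].
    rewrite RtoC_div by lra.
    assert (RtoC (INR (fact n)) <> RtoC 0) by (apply RtoC_neq_0, INR_fact_neq_0).
    field. auto. }
  assert (Hval : forall w, Cmod w < r ->
    taylor_remainder phi r 0 w = (RtoC (2 * PI) * p (z0 + w)%C)%C).
  { intros w Hw. pose proof (HC 0%nat (z0 + w)%C) as E.
    replace (z0 + w - z0)%C with w in E by ring. specialize (E Hw).
    change (C_derive_n p 0 (z0 + w)%C) with (p (z0 + w)%C) in E. rewrite E.
    unfold taylor_remainder, cauchy_type. rewrite RtoC_div by lra.
    rewrite (CInt_ext (fun t => phi t * / (RtoC r * cis t) ^ 0 * / (RtoC r * cis t - w))%C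
       (fun t => phi t * / (RtoC r * cis t - w) ^ 1)%C); [|lra|].
    - change (INR (fact 0)) with 1. field. exact P2.
    - intros t _. rewrite Cpow_1_r.
      replace ((RtoC r * cis t) ^ 0)%C with (RtoC 1) by reflexivity.
      field. apply polar_minus_neq_0, Hw. }
  assert (Hc0 : cauchy_type phi r 0 (RtoC 0) = (RtoC (2 * PI) * p z0)%C).
  { rewrite Hc. simpl. field. }
  set (A := 4 * PI * M / r).
  assert (A0 : 0 <= A) by (unfold A; apply Rdiv_le_0_compat; [|lra]; apply Rmult_le_pos; lra).
  destruct (LPO_min (fun n => C_derive_n p (S n) z0 <> RtoC 0)) as [[k [Hk Hmin]]|Hall].
  { intros n. destruct (Ceq_dec (C_derive_n p (S n) z0) (RtoC 0)); tauto. }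
  - right. exists (S k), (A * / r ^ S (S k) / (2 * PI)), (r / 2).
    assert (Pn : 0 < r ^ S (S k)) by (apply pow_lt; lra).
    split; [split; [lia|]; split; [exact Hk|]|].
    { intros [|l] Hl; [lia|].
      destruct (Ceq_dec (C_derive_n p (S l) z0) (RtoC 0)) as [E|E]; [exact E|].
      exfalso. apply (Hmin l); [lia|exact E]. }
    split; [|split; [lra|]].
    { apply Rdiv_le_0_compat; [|lra].
      apply Rmult_le_pos; [exact A0|apply Rlt_le, Rinv_0_lt_compat, Pn]. }
    intros w Hw. assert (Hw' : Cmod w < r) by lra.
    assert (Vanish : forall i, (1 <= i <= k)%nat -> cauchy_type phi r i (RtoC 0) = RtoC 0).
    { intros [|i] Hi; [lia|]. rewrite Hc.
      destruct (Ceq_dec (C_derive_n p (S i) z0) (RtoC 0)) as [E|E].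
      - rewrite E. unfold Cdiv. ring.
      - exfalso. apply (Hmin i); [lia|exact E]. }
    pose proof (taylor_expansion_vanishing phi r w k Hphi (proj1 Hr) Hw' Vanish) as E.
    rewrite (taylor_remainder_step phi r (S k)), Hval, Hc0, Hc in E
      by (assumption || lra).
    set (q := (C_derive_n p (S k) z0 / RtoC (INR (fact (S k))))%C) in *.
    set (T := taylor_remainder phi r (S (S k)) w) in *.
    replace (p (z0 + w)%C - p z0 - q * w ^ S k)%C
      with (w ^ S (S k) * T / RtoC (2 * PI))%C.
    2:{ rewrite (Cpow_S w (S k)).
        replace (w * w ^ S k * T)%C with
          (RtoC (2 * PI) * p (z0 + w)%C - RtoC (2 * PI) * p z0
           - w ^ S k * (RtoC (2 * PI) * q))%C by (rewrite E; ring).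
        field. exact P2. }
    rewrite Cmod_div, Cmod_mult, Cmod_pow, Cmod_R, Rabs_pos_eq by (exact P2 || lra).
    assert (BT : Cmod T <= A * / r ^ S (S k))
      by (apply taylor_remainder_bound; try assumption; lra).
    unfold Rdiv. rewrite (Rmult_comm _ (Cmod w ^ S (S k))), <- Rmult_assoc.
    apply Rmult_le_compat_r; [apply Rlt_le, Rinv_0_lt_compat; lra|].
    apply Rmult_le_compat_l; [apply pow_le, Cmod_ge_0|exact BT].
  - left. apply locally_C_eps. exists (r / 2). split; [lra|]. intros z Hz.
    set (w := (z - z0)%C) in *. assert (Hw' : Cmod w < r) by lra.
    assert (Vanish : forall i n, (1 <= i <= n)%nat -> cauchy_type phi r i (RtoC 0) = RtoC 0).
    { intros [|i] n Hi; [lia|]. rewrite Hc.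
      destruct (Ceq_dec (C_derive_n p (S i) z0) (RtoC 0)) as [E|E].
      - rewrite E. unfold Cdiv. ring.
      - exfalso. exact (Hall i E). }
    assert (E : forall n, Cmod (RtoC (2 * PI) * (p z - p z0)) <= A * (/ 2) ^ S n).
    { intros n.
      pose proof (taylor_expansion_vanishing phi r w n Hphi (proj1 Hr) Hw'
                    (fun i => Vanish i n)) as E.
      rewrite Hval, Hc0 in E by exact Hw'.
      replace (z0 + w)%C with z in E by (unfold w; ring).
      replace (RtoC (2 * PI) * (p z - p z0))%C with
        (RtoC (2 * PI) * p z - RtoC (2 * PI) * p z0)%C by ring.
      rewrite E.
      match goal with |- Cmod ?x <= _ => replace x with
        (w ^ S n * taylor_remainder phi r (S n) w)%C by ring end.
      rewrite Cmod_mult, Cmod_pow.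
      assert (Pn : 0 < r ^ S n) by (apply pow_lt; lra).
      apply Rle_trans with ((r / 2) ^ S n * (A * / r ^ S n)).
      - apply Rmult_le_compat; [apply pow_le, Cmod_ge_0|apply Cmod_ge_0| |].
        + apply pow_incr. split; [apply Cmod_ge_0|lra].
        + apply taylor_remainder_bound; try assumption; lra.
      - right. unfold Rdiv. rewrite Rpow_mult_distr. field. lra. }
    assert (Z : Cmod (RtoC (2 * PI) * (p z - p z0)) <= 0).
    { change (Rbar_le (Cmod (RtoC (2 * PI) * (p z - p z0))) 0).
      apply (is_lim_seq_le (fun _ => Cmod (RtoC (2 * PI) * (p z - p z0)))
               (fun n => A * (/ 2) ^ S n) _ 0 E).
      - apply is_lim_seq_const.
      - replace (Finite 0) with (Rbar_mult A 0) by (simpl; f_equal; ring).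
        apply (is_lim_seq_scal_l (fun n => (/ 2) ^ S n) A 0).
        apply (is_lim_seq_incr_1 (fun n => (/ 2) ^ n)).
        apply is_lim_seq_geom. rewrite Rabs_pos_eq; lra. }
    apply Ceq_minus.
    assert (Z' : (RtoC (2 * PI) * (p z - p z0))%C = RtoC 0)
      by (apply Cmod_eq_0; pose proof (Cmod_ge_0 (RtoC (2 * PI) * (p z - p z0))); lra).
    replace (p z - p z0)%C with (RtoC (2 * PI) * (p z - p z0) / RtoC (2 * PI))%C
      by (field; exact P2).
    rewrite Z'. unfold Cdiv. ring.
Qed.

(** * Growth of the modulus along rays *)

(** The leading term dominates as soon as [(M + 1) t < c]. *)
Lemma eventually_positive (h : R -> R) (k : nat) (c M d : R) :
  0 < c -> 0 <= M -> 0 < d ->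
  (forall t, 0 < t < d -> Rabs (h t - c * t ^ k) <= M * t ^ S k) ->
  exists tstar, 0 < tstar /\ forall t, 0 < t < tstar -> 0 < h t.
Proof.
  intros Hc HM Hd H.
  exists (Rmin d (c / (M + 1))). split.
  { apply Rmin_glb_lt; [exact Hd|]. apply Rdiv_lt_0_compat; lra. }
  intros t [t0 Ht].
  assert (H1 := Rlt_le_trans _ _ _ Ht (Rmin_l _ _)).
  assert (H2 := Rlt_le_trans _ _ _ Ht (Rmin_r _ _)).
  apply Rlt_div_r in H2; [|lra].
  specialize (H t (conj t0 H1)). apply Rabs_le_between in H.
  simpl in H. assert (P : 0 < t ^ k) by (apply pow_lt, t0).
  assert (0 < (c - M * t) * t ^ k) by (apply Rmult_lt_0_compat; nra).
  lra.
Qed.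

Lemma eventually_negative (h : R -> R) (k : nat) (c M d : R) :
  c < 0 -> 0 <= M -> 0 < d ->
  (forall t, 0 < t < d -> Rabs (h t - c * t ^ k) <= M * t ^ S k) ->
  exists tstar, 0 < tstar /\ forall t, 0 < t < tstar -> h t < 0.
Proof.
  intros Hc HM Hd H.
  destruct (eventually_positive (fun t => - h t) k (- c) M d) as [s [s0 Hs]]; try lra.
  - intros t Ht. rewrite <- Rabs_Ropp.
    replace (- (- h t - - c * t ^ k)) with (h t - c * t ^ k) by ring. apply H, Ht.
  - exists s. split; [exact s0|]. intros t Ht. specialize (Hs t Ht). lra.
Qed.

Lemma Cmod_sqr (z : C) : Cmod z ^ 2 = Re z ^ 2 + Im z ^ 2.
Proof. unfold Cmod, Re, Im. apply pow2_sqrt. nra. Qed.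

Lemma Cmod_lt_of_sqr (z w : C) : 0 < Cmod w ^ 2 - Cmod z ^ 2 -> Cmod z < Cmod w.
Proof. pose proof (Cmod_ge_0 z). pose proof (Cmod_ge_0 w). intros. nra. Qed.

Lemma cis_pow (t : R) (k : nat) : (cis t ^ k)%C = cis (INR k * t).
Proof.
  induction k as [|k IH].
  - rewrite Rmult_0_l. unfold cis. rewrite cos_0, sin_0. reflexivity.
  - rewrite Cpow_S, IH, <- cis_plus, S_INR. f_equal. ring.
Qed.

Lemma im_le_Cmod (z : C) : Rabs (Im z) <= Cmod z.
Proof. eapply Rle_trans; [apply Rmax_r|exact (Rmax_Cmod z)]. Qed.

(** Expanding [|p0 + u|^2], the linear term [2 Re (conj p0 u)] carries the
    leading coefficient and [|u|^2] is of order [2 k >= k + 1]. *)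
Lemma modulus_leading_term (p : C -> C) (z0 q : C) (k : nat) (M d r alpha theta : R) :
  (1 <= k)%nat -> 0 <= M -> 0 < d ->
  (forall w, Cmod w < d ->
     Cmod (p (z0 + w)%C - p z0 - q * w ^ k) <= M * Cmod w ^ S k) ->
  (Cconj (p z0) * q)%C = (RtoC r * cis alpha)%C ->
  forall t, 0 < t < Rmin d 1 ->
  Rabs (Cmod (p (z0 + RtoC t * cis theta)%C) ^ 2 - Cmod (p z0) ^ 2
        - 2 * r * cos (alpha + INR k * theta) * t ^ k)
  <= (2 * Cmod (p z0) * M + (Cmod q + M) ^ 2) * t ^ S k.
Proof.
  intros Hk HM Hd H Hq t [t0 Ht].
  assert (H1 := Rlt_le_trans _ _ _ Ht (Rmin_l _ _)).
  assert (H2 := Rlt_le_trans _ _ _ Ht (Rmin_r _ _)).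
  set (w := (RtoC t * cis theta)%C).
  assert (Mw : Cmod w = t) by (apply Cmod_polar; lra).
  specialize (H w ltac:(lra)). rewrite Mw in H.
  set (p1 := p (z0 + w)%C) in *. set (p0 := p z0) in *.
  set (e := (p1 - p0 - q * w ^ k)%C) in *.
  set (u := (q * w ^ k + e)%C).
  assert (E1 : p1 = (p0 + u)%C) by (unfold u, e; ring).
  assert (Pk : 0 < t ^ k) by (apply pow_lt, t0).
  assert (Bu : Cmod u <= (Cmod q + M) * t ^ k).
  { eapply Rle_trans; [apply Cmod_triangle|].
    rewrite Cmod_mult, Cmod_pow, Mw. simpl in H.
    assert (M * (t * t ^ k) <= M * t ^ k) by (apply Rmult_le_compat_l; nra).
    lra. }
  assert (Bu2 : Cmod u ^ 2 <= (Cmod q + M) ^ 2 * t ^ S k).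
  { apply Rle_trans with (((Cmod q + M) * t ^ k) ^ 2).
    - apply pow_incr. split; [apply Cmod_ge_0|exact Bu].
    - rewrite Rpow_mult_distr. apply Rmult_le_compat_l; [apply pow2_ge_0|].
      replace ((t ^ k) ^ 2) with (t ^ k * t ^ k) by ring.
      destruct k as [|k]; [lia|]. simpl.
      assert (0 < t ^ k) by (apply pow_lt, t0).
      assert (t ^ k <= 1) by (rewrite <- (pow1 k); apply pow_incr; lra).
      assert (0 < t * t) by nra.
      replace (t * t ^ k * (t * t ^ k)) with (t * t * (t ^ k * t ^ k)) by ring.
      replace (t * (t * t ^ k)) with (t * t * t ^ k) by ring.
      apply Rmult_le_compat_l; nra. }
  assert (Main : Re (Cconj p0 * (q * w ^ k)) = r * cos (alpha + INR k * theta) * t ^ k).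
  { unfold w. rewrite Cpow_mult_l, cis_pow, <- RtoC_pow.
    replace (Cconj p0 * (q * (RtoC (t ^ k) * cis (INR k * theta))))%C
      with (RtoC r * (cis alpha * cis (INR k * theta)) * RtoC (t ^ k))%C
      by (rewrite (Cmult_assoc (Cconj p0)), Hq; ring).
    rewrite <- cis_plus. simpl. ring. }
  assert (Err : Rabs (Re (Cconj p0 * e)) <= Cmod p0 * (M * t ^ S k)).
  { eapply Rle_trans; [apply re_le_Cmod|]. rewrite Cmod_mult, Cmod_conj.
    apply Rmult_le_compat_l; [apply Cmod_ge_0|exact H]. }
  replace (Cmod p1 ^ 2 - Cmod p0 ^ 2 - 2 * r * cos (alpha + INR k * theta) * t ^ k)
    with (2 * Re (Cconj p0 * e) + Cmod u ^ 2).
  2:{ assert (X : Cmod p1 ^ 2 = Cmod p0 ^ 2 + 2 * Re (Cconj p0 * u) + Cmod u ^ 2).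
      { rewrite E1, !Cmod_sqr. unfold Re, Im. simpl. ring. }
      assert (Y : Re (Cconj p0 * u) = Re (Cconj p0 * (q * w ^ k)) + Re (Cconj p0 * e)).
      { unfold u, Re. simpl. ring. }
      rewrite X, Y, Main. ring. }
  eapply Rle_trans; [apply Rabs_triang|].
  rewrite Rabs_mult, (Rabs_pos_eq 2), (Rabs_pos_eq (Cmod u ^ 2))
    by (lra || apply pow2_ge_0). lra.
Qed.

(** Conjugation on both sides preserves holomorphy (Schwarz reflection). *)
Lemma is_derive_conj_conj (f : C -> C) (z l : C) :
  is_derive f (Cconj z) l ->
  is_derive (fun w => Cconj (f (Cconj w))) z (Cconj l).
Proof.
  rewrite !is_derive_C_eps. intros Hf eps He.
  destruct (Hf eps He) as [d [d0 Hd]]. exists d. split; [exact d0|]. intros w Hw.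
  rewrite <- (Cconj_conj (w - z)%C) at 1.
  rewrite <- Cmult_conj, <- !Cminus_conj, Cmod_conj, <- (Cmod_conj (w - z)%C), Cminus_conj.
  apply Hd. rewrite <- Cminus_conj, Cmod_conj. exact Hw.
Qed.

(** [|p|^2] along a ray is the restriction to the real axis of a holomorphic
    function of one complex variable, so it is constant or eventually strictly
    above or below its initial value. *)
Lemma ray_trichotomy (p : C -> C) (z0 : C) (theta : R) :
  holomorphic_near p z0 -> circle_angle theta ->
  level_ray p z0 theta \/ cone_of_ascent p z0 theta \/ cone_of_descent p z0 theta.
Proof.
  intros Hp Hth.
  set (g := fun z : C => p (z0 + z * cis theta)%C).
  set (Q := fun z : C => (g z * Cconj (g (Cconj z)))%C).
  assert (Qt : forall t : R, Q (RtoC t) = RtoC (Cmod (p (z0 + RtoC t * cis theta)%C) ^ 2)).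
  { intros t. unfold Q. replace (Cconj (RtoC t)) with (RtoC t)
      by (apply injective_projections; simpl; ring).
    rewrite <- Cmod2_conj. reflexivity. }
  assert (Q0 : Q (RtoC 0) = RtoC (Cmod (p z0) ^ 2)).
  { rewrite Qt. replace (z0 + RtoC 0 * cis theta)%C with z0 by ring. reflexivity. }
  assert (HQ : holomorphic_near Q (RtoC 0)).
  { unfold holomorphic_near in Hp. apply locally_C_eps in Hp. destruct Hp as [R0 [HR0 Hp]].
    apply locally_C_eps. exists R0. split; [exact HR0|]. intros w Hw.
    replace (w - RtoC 0)%C with w in Hw by ring.
    assert (Hg : forall z, Cmod z < R0 -> exists l : C, is_derive g z l).
    { intros z Hz. destruct (Hp (z0 + z * cis theta)%C) as [l Hl].
      { replace (z0 + z * cis theta - z0)%C with (z * cis theta)%C by ring.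
        rewrite Cmod_mult, Cmod_cis. lra. }
      eexists. unfold g. apply (is_derive_Ccomp p (fun z => z0 + z * cis theta)%C); [exact Hl|].
      apply is_derive_Cplus; [apply is_derive_Cconst|].
      apply is_derive_Cmult; [apply is_derive_Cid|apply is_derive_Cconst]. }
    destruct (Hg w Hw) as [l1 L1].
    destruct (Hg (Cconj w)) as [l2 L2]; [rewrite Cmod_conj; exact Hw|].
    eexists. apply (is_derive_Cmult g (fun z => Cconj (g (Cconj z)))); [exact L1|].
    apply is_derive_conj_conj, L2. }
  destruct (holomorphic_leading_term Q (RtoC 0) HQ) as [HC|[k [M [d [[_ [Hk _]] [HM [Hd H]]]]]]].
  - left. unfold constant_near in HC. apply locally_C_eps in HC. destruct HC as [d [d0 HC]].
    exists d. split; [exact d0|]. intros t Ht.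
    assert (E : Q (RtoC t) = Q (RtoC 0)).
    { apply HC. replace (RtoC t - RtoC 0)%C with (RtoC t) by ring.
      rewrite Cmod_R, Rabs_pos_eq; lra. }
    rewrite Qt, Q0 in E. apply RtoC_inj in E.
    set (a := Cmod (p (z0 + RtoC t * cis theta)%C)) in *.
    assert (0 <= a) by apply Cmod_ge_0. pose proof (Cmod_ge_0 (p z0)). nra.
  - right.
    set (c := (C_derive_n Q k (RtoC 0) / RtoC (INR (fact k)))%C) in *.
    assert (Hc : c <> RtoC 0).
    { unfold c. intros K. apply Hk.
      assert (F0 : RtoC (INR (fact k)) <> RtoC 0) by (apply RtoC_neq_0, INR_fact_neq_0).
      replace (C_derive_n Q k (RtoC 0)) with
        (C_derive_n Q k (RtoC 0) / RtoC (INR (fact k)) * RtoC (INR (fact k)))%C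
        by (field; exact F0).
      rewrite K. ring. }
    assert (Ht : forall t, 0 < t < d ->
      Cmod (RtoC (Cmod (p (z0 + RtoC t * cis theta)%C) ^ 2 - Cmod (p z0) ^ 2)
            - c * RtoC (t ^ k)) <= M * t ^ S k).
    { intros t Ht.
      assert (Mt : Cmod (RtoC t) = t) by (rewrite Cmod_R, Rabs_pos_eq; lra).
      specialize (H (RtoC t) ltac:(lra)).
      rewrite Mt, Cplus_0_l, Qt, Q0, <- RtoC_pow in H.
      rewrite RtoC_minus. exact H. }
    (* [Q] is real on the real axis, so its leading coefficient is real;
       otherwise the leading imaginary part would make [0] positive. *)
    assert (Ic : Im c = 0).
    { destruct (Req_dec (Im c) 0) as [E|E]; [exact E|]. exfalso.
      destruct (eventually_positive (fun _ => 0) k (Rabs (Im c)) M d) as [s [s0 Hs]].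
      - apply Rabs_pos_lt, E.
      - exact HM.
      - exact Hd.
      - intros t Htd. specialize (Ht t Htd).
        eapply Rle_trans; [|exact Ht]. eapply Rle_trans; [|apply im_le_Cmod].
        assert (0 < t ^ k) by (apply pow_lt; lra).
        rewrite <- (Rabs_pos_eq (t ^ k)) by lra.
        rewrite <- Rabs_mult, Rminus_0_l, Rabs_Ropp, Rabs_Rabsolu.
        right. rewrite <- Rabs_Ropp. f_equal.
        unfold Im. simpl. rewrite (Rabs_pos_eq (t ^ k)) by lra. ring.
      - specialize (Hs (s / 2) ltac:(lra)). lra. }
    assert (Rc : Re c <> 0).
    { intros E. apply Hc. apply injective_projections; assumption. }
    assert (Hr : forall t, 0 < t < d ->
      Rabs (Cmod (p (z0 + RtoC t * cis theta)%C) ^ 2 - Cmod (p z0) ^ 2 - Re c * t ^ k)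
      <= M * t ^ S k).
    { intros t Htd. eapply Rle_trans; [|exact (Ht t Htd)].
      eapply Rle_trans; [|apply re_le_Cmod]. right. f_equal. unfold Re. simpl. ring. }
    destruct (Rtotal_order (Re c) 0) as [L|[E|L]]; [right|contradiction|left].
    + destruct (eventually_negative _ k (Re c) M d L HM Hd Hr) as [s [s0 Hs]].
      split; [exact Hth|]. exists s. split; [exact s0|]. intros t Htd.
      apply Cmod_lt_of_sqr. specialize (Hs t Htd). cbv beta in Hs. lra.
    + destruct (eventually_positive _ k (Re c) M d L HM Hd Hr) as [s [s0 Hs]].
      split; [exact Hth|]. exists s. split; [exact s0|]. intros t Htd.
      apply Cmod_lt_of_sqr. specialize (Hs t Htd). exact Hs.
Qed.

(** * Sectors *)

Lemma cos_period_Z (x : R) (n : Z) : cos (x + 2 * IZR n * PI) = cos x.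
Proof.
  destruct (Z_le_gt_dec 0 n) as [Hn|Hn].
  - rewrite <- (Z2Nat.id n Hn), <- INR_IZR_INZ. apply cos_period.
  - rewrite <- (cos_period (x + 2 * IZR n * PI) (Z.to_nat (- n))).
    rewrite INR_IZR_INZ, Z2Nat.id, opp_IZR by lia. f_equal. ring.
Qed.

(** The affine coordinate in which the division angles are the integers:
    sector [j] is the interval from [j] to [j + 1], and a full turn is a
    translation by [2 k]. *)
Definition sector_coordinate (k : nat) (alpha theta : R) : R :=
  (INR k * theta + alpha) / PI + / 2.

Lemma division_angle_coordinate (k : nat) (alpha : R) (j : nat) (phi : R) :
  (1 <= k)%nat ->
  INR j - sector_coordinate k alpha phi =
  INR k / PI * (division_angle k alpha j - phi).
Proof.
  intros Hk. assert (0 < INR k) by (apply lt_0_INR; lia). pose proof PI_RGT_0.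
  unfold sector_coordinate, division_angle. field. lra.
Qed.

Lemma sector_coordinate_shift (k : nat) (alpha theta : R) (n : Z) :
  sector_coordinate k alpha (theta + IZR n * (2 * PI)) =
  sector_coordinate k alpha theta + IZR (2 * Z.of_nat k * n).
Proof.
  pose proof PI_RGT_0. unfold sector_coordinate.
  rewrite !mult_IZR, <- INR_IZR_INZ. field. lra.
Qed.

Lemma open_sector_coordinate (k : nat) (alpha : R) (j : nat) (theta : R) :
  (1 <= k)%nat ->
  open_sector k alpha j theta <->
  circle_angle theta /\ exists n : Z,
    IZR (Z.of_nat j + 2 * Z.of_nat k * n) < sector_coordinate k alpha theta
      < IZR (Z.of_nat j + 2 * Z.of_nat k * n) + 1.
Proof.
  intros Hk. assert (K0 : 0 < INR k) by (apply lt_0_INR; lia). pose proof PI_RGT_0 as Hpi.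
  assert (KP : 0 < INR k / PI) by (apply Rdiv_lt_0_compat; lra).
  assert (Cmp : forall i phi,
    (division_angle k alpha i < phi <-> INR i < sector_coordinate k alpha phi) /\
    (phi < division_angle k alpha i <-> sector_coordinate k alpha phi < INR i)).
  { intros i phi. pose proof (division_angle_coordinate k alpha i phi Hk) as E.
    split; split; intros L.
    - assert (0 < INR k / PI * (phi - division_angle k alpha i))
        by (apply Rmult_lt_0_compat; lra). lra.
    - apply Rnot_le_lt. intros L'.
      assert (0 <= INR k / PI * (division_angle k alpha i - phi))
        by (apply Rmult_le_pos; lra). lra.
    - assert (0 < INR k / PI * (division_angle k alpha i - phi))
        by (apply Rmult_lt_0_compat; lra). lra.
    - apply Rnot_le_lt. intros L'.
      assert (0 <= INR k / PI * (phi - division_angle k alpha i))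
        by (apply Rmult_le_pos; lra). lra. }
  unfold open_sector, congruent_mod. split.
  - intros [Hc [phi [[L1 L2] [n ->]]]]. split; [exact Hc|]. exists n.
    apply (Cmp j phi) in L1. apply (Cmp (S j) phi) in L2. rewrite S_INR in L2.
    rewrite sector_coordinate_shift, plus_IZR, <- INR_IZR_INZ. lra.
  - intros [Hc [n Hn]]. split; [exact Hc|].
    exists (theta + IZR (- n) * (2 * PI)). split.
    + assert (E := sector_coordinate_shift k alpha theta (- n)).
      replace (2 * Z.of_nat k * - n)%Z with (- (2 * Z.of_nat k * n))%Z in E by ring.
      rewrite plus_IZR, <- INR_IZR_INZ in Hn. rewrite (opp_IZR (2 * _ * _)) in E.
      split; [apply Cmp; lra|]. apply Cmp. rewrite S_INR. lra.
    + exists n. rewrite opp_IZR. ring.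
Qed.

Lemma boundary_point_coordinate (k : nat) (alpha : R) (j : nat) (theta : R) :
  (1 <= k)%nat ->
  boundary_point k alpha j theta <->
  circle_angle theta /\ exists n : Z,
    sector_coordinate k alpha theta = IZR (Z.of_nat j + 2 * Z.of_nat k * n).
Proof.
  intros Hk. assert (K0 : 0 < INR k) by (apply lt_0_INR; lia). pose proof PI_RGT_0 as Hpi.
  assert (KP : 0 < INR k / PI) by (apply Rdiv_lt_0_compat; lra).
  unfold boundary_point, congruent_mod. split.
  - intros [Hc [n ->]]. split; [exact Hc|]. exists n.
    rewrite sector_coordinate_shift, plus_IZR, <- INR_IZR_INZ. f_equal.
    pose proof (division_angle_coordinate k alpha j (division_angle k alpha j) Hk) as E.
    rewrite Rminus_diag, Rmult_0_r in E. lra.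
  - intros [Hc [n Hn]]. split; [exact Hc|]. exists n.
    assert (E := sector_coordinate_shift k alpha theta (- n)).
    replace (2 * Z.of_nat k * - n)%Z with (- (2 * Z.of_nat k * n))%Z in E by ring.
    rewrite plus_IZR, <- INR_IZR_INZ in Hn. rewrite !opp_IZR in E.
    pose proof (division_angle_coordinate k alpha j (theta + - IZR n * (2 * PI)) Hk) as D.
    rewrite E, Hn in D.
    assert (Z : INR k / PI * (division_angle k alpha j - (theta + - IZR n * (2 * PI))) = 0)
      by lra.
    apply Rmult_integral in Z. destruct Z; lra.
Qed.

Lemma sector_index_unique (k i j : nat) (m n : Z) :
  (i < 2 * k)%nat -> (j < 2 * k)%nat ->
  (Z.of_nat i + 2 * Z.of_nat k * m = Z.of_nat j + 2 * Z.of_nat k * n)%Z -> i = j.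
Proof.
  intros Hi Hj E. apply Nat2Z.inj.
  rewrite <- (Z.mod_small (Z.of_nat i) (2 * Z.of_nat k)) by lia.
  rewrite <- (Z.mod_small (Z.of_nat j) (2 * Z.of_nat k)) by lia.
  replace (Z.of_nat j) with (Z.of_nat i + (m - n) * (2 * Z.of_nat k))%Z by lia.
  symmetry. apply Z_mod_plus_full.
Qed.

(** The sector or division angle of [theta] is found from the integer part of its
    coordinate, reduced modulo [2 k]. *)
Lemma sectors_decompose (k : nat) (alpha : R) :
  (1 <= k)%nat -> sectors_decompose_circle k alpha.
Proof.
  intros Hk. split.
  - intros theta Hth.
    destruct (archimed (sector_coordinate k alpha theta)) as [A1 A2].
    (* [up x] is the least integer above [x], so [N] is the integer part. *)
    set (N := (up (sector_coordinate k alpha theta) - 1)%Z).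
    assert (HN : IZR N = IZR (up (sector_coordinate k alpha theta)) - 1)
      by (unfold N; rewrite minus_IZR; reflexivity).
    pose proof (Z.mod_pos_bound N (2 * Z.of_nat k) ltac:(lia)) as Hmod.
    exists (Z.to_nat (N mod (2 * Z.of_nat k))). split; [lia|].
    assert (EN : (Z.of_nat (Z.to_nat (N mod (2 * Z.of_nat k)))
                  + 2 * Z.of_nat k * (N / (2 * Z.of_nat k)))%Z = N).
    { rewrite Z2Nat.id by lia.
      pose proof (Z.div_mod N (2 * Z.of_nat k) ltac:(lia)). lia. }
    destruct (Req_dec (sector_coordinate k alpha theta) (IZR N)) as [E|E].
    + right. apply boundary_point_coordinate; [exact Hk|]. split; [exact Hth|].
      exists (N / (2 * Z.of_nat k))%Z. rewrite EN. exact E.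
    + left. apply open_sector_coordinate; [exact Hk|]. split; [exact Hth|].
      exists (N / (2 * Z.of_nat k))%Z. rewrite EN. lra.
  - intros i j theta Hi Hj.
    rewrite !open_sector_coordinate, !boundary_point_coordinate by exact Hk.
    split; [|split].
    + intros [_ [m Hm]] [_ [n Hn]].
      apply (sector_index_unique k i j m n Hi Hj).
      apply Z.le_antisymm; apply Zlt_succ_le, lt_IZR; rewrite succ_IZR; lra.
    + intros [_ [m Hm]] [_ [n Hn]].
      apply (sector_index_unique k i j m n Hi Hj).
      apply eq_IZR. congruence.
    + intros [[_ [m Hm]] [_ [n Hn]]]. rewrite Hn in Hm. destruct Hm as [M1 M2].
      apply lt_IZR in M1. rewrite <- succ_IZR in M2. apply lt_IZR in M2. lia.
Qed.

(** The angle [alpha + k theta] is [(x - 1/2) pi], where [x] is the coordinate of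
    [theta]. *)
Lemma cos_pos_coordinate (k : nat) (alpha theta : R) (m : Z) :
  IZR (2 * m) < sector_coordinate k alpha theta < IZR (2 * m) + 1 ->
  0 < cos (alpha + INR k * theta).
Proof.
  intros H. pose proof PI_RGT_0 as Hpi.
  rewrite <- (cos_period_Z _ (- m)). rewrite opp_IZR.
  rewrite mult_IZR in H.
  assert (E : alpha + INR k * theta = (sector_coordinate k alpha theta - / 2) * PI)
    by (unfold sector_coordinate; field; lra).
  rewrite E. apply cos_gt_0; nra.
Qed.

Lemma cos_neg_coordinate (k : nat) (alpha theta : R) (m : Z) :
  IZR (2 * m + 1) < sector_coordinate k alpha theta < IZR (2 * m + 1) + 1 ->
  cos (alpha + INR k * theta) < 0.
Proof.
  intros H. pose proof PI_RGT_0 as Hpi.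
  rewrite <- (cos_period_Z _ (- m)). rewrite opp_IZR.
  rewrite plus_IZR, mult_IZR in H.
  assert (E : alpha + INR k * theta = (sector_coordinate k alpha theta - / 2) * PI)
    by (unfold sector_coordinate; field; lra).
  rewrite E. apply cos_lt_0; nra.
Qed.

Lemma open_sector_parity (k : nat) (alpha : R) (j : nat) (theta : R) :
  (1 <= k)%nat -> open_sector k alpha j theta ->
  (Nat.Even j -> 0 < cos (alpha + INR k * theta)) /\
  (Nat.Odd j -> cos (alpha + INR k * theta) < 0).
Proof.
  intros Hk Hs. apply open_sector_coordinate in Hs; [|exact Hk].
  destruct Hs as [_ [n Hn]]. split; intros [i ->].
  - apply (cos_pos_coordinate k alpha theta (Z.of_nat i + Z.of_nat k * n)).
    replace (2 * (Z.of_nat i + Z.of_nat k * n))%Z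
      with (Z.of_nat (2 * i) + 2 * Z.of_nat k * n)%Z by lia. exact Hn.
  - apply (cos_neg_coordinate k alpha theta (Z.of_nat i + Z.of_nat k * n)).
    replace (2 * (Z.of_nat i + Z.of_nat k * n) + 1)%Z
      with (Z.of_nat (2 * i + 1) + 2 * Z.of_nat k * n)%Z by lia. exact Hn.
Qed.

Lemma ascent_criterion_cos (k : nat) (alpha theta phi : R) :
  (1 <= k)%nat ->
  (- 2 * alpha - PI) / (2 * INR k) < phi < (- 2 * alpha + PI) / (2 * INR k) ->
  congruent_mod (2 * PI / INR k) theta phi ->
  0 < cos (alpha + INR k * theta).
Proof.
  intros Hk [H1 H2] [n ->]. assert (K0 : 0 < INR k) by (apply lt_0_INR; lia).
  apply Rlt_div_l in H1; [|lra]. apply Rlt_div_r in H2; [|lra].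
  replace (alpha + INR k * (phi + IZR n * (2 * PI / INR k)))
    with (alpha + INR k * phi + 2 * IZR n * PI) by (field; lra).
  rewrite cos_period_Z. apply cos_gt_0; lra.
Qed.

Theorem mainTheorem1 (z0 : C) (p : C -> C)
    (p_holo : holomorphic_near p z0) (p_nonconst : ~ constant_near p z0) :
  (p z0 = RtoC 0 ->
     forall theta : R, cone_of_ascent p z0 theta <-> 0 <= theta < 2 * PI) /\
  (p z0 <> RtoC 0 ->
     exists k : nat, first_nonzero_derivative p z0 k /\
       forall r alpha : R, 0 < r ->
         (Cconj (p z0) * C_derive_n p k z0)%C = (RtoC r * cis alpha)%C ->
         (* the cones partition the circle into alternating sectors *)
         (forall theta : R,
            ~ (cone_of_ascent p z0 theta /\ cone_of_descent p z0 theta)) /\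
         sectors_decompose_circle k alpha /\
         (forall (j : nat) (theta : R), (j < 2 * k)%nat -> Nat.Even j ->
            open_sector k alpha j theta -> cone_of_ascent p z0 theta) /\
         (* the interiors of the remaining sectors *)
         (forall (j : nat) (theta : R), (j < 2 * k)%nat -> Nat.Odd j ->
            open_sector k alpha j theta -> cone_of_descent p z0 theta) /\
         (* the explicit criterion for ascent *)
         (forall theta : R, 0 <= theta < 2 * PI ->
            (exists phi : R,
               (- 2 * alpha - PI) / (2 * INR k) < phi
                 < (- 2 * alpha + PI) / (2 * INR k) /\
               congruent_mod (2 * PI / INR k) theta phi) ->
            cone_of_ascent p z0 theta) /\
         (* the boundary points *)
         (forall (j : nat) (theta : R), (j < 2 * k)%nat ->
            boundary_point k alpha j theta -> ~ level_ray p z0 theta ->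
            cone_of_ascent p z0 theta \/ cone_of_descent p z0 theta)).
Proof.
  destruct (holomorphic_leading_term p z0 p_holo)
    as [HC|[k [M [d [Hk [HM [Hd H]]]]]]]; [contradiction|].
  assert (Fk : 0 < INR (fact k)) by apply INR_fact_lt_0.
  assert (Fk' : RtoC (INR (fact k)) <> RtoC 0) by (apply RtoC_neq_0; lra).
  assert (Hk1 : (1 <= k)%nat) by apply Hk.
  split.
  - intros Hz theta. split; [intros [Hth _]; exact Hth|]. intros Hth. split; [exact Hth|].
    set (q := (C_derive_n p k z0 / RtoC (INR (fact k)))%C) in *.
    assert (Hq : 0 < Cmod q).
    { unfold q. rewrite Cmod_div by exact Fk'. apply Rdiv_lt_0_compat.
      - apply Cmod_gt_0, Hk.
      - apply Cmod_gt_0, Fk'. }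
    rewrite Hz, Cmod_0.
    apply (eventually_positive (fun t => Cmod (p (z0 + RtoC t * cis theta)%C)) k (Cmod q) M d);
      try assumption.
    intros t Ht.
    set (w := (RtoC t * cis theta)%C).
    assert (Mw : Cmod w = t) by (apply Cmod_polar; lra).
    specialize (H w ltac:(lra)). rewrite Hz, Mw in H.
    replace (p (z0 + w)%C - RtoC 0 - q * w ^ k)%C with (p (z0 + w)%C - q * w ^ k)%C in H by ring.
    eapply Rle_trans; [|exact H].
    replace (Cmod q * t ^ k) with (Cmod (q * w ^ k)) by (rewrite Cmod_mult, Cmod_pow, Mw; ring).
    apply Rabs_le_between'.
    pose proof (Cmod_triangle (p (z0 + w)%C - q * w ^ k) (q * w ^ k)) as T1.
    pose proof (Cmod_triangle (q * w ^ k - p (z0 + w)%C) (p (z0 + w)%C)) as T2.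
    replace (p (z0 + w)%C - q * w ^ k + q * w ^ k)%C with (p (z0 + w)%C) in T1 by ring.
    replace (q * w ^ k - p (z0 + w)%C + p (z0 + w)%C)%C with (q * w ^ k)%C in T2 by ring.
    replace (q * w ^ k - p (z0 + w)%C)%C with (- (p (z0 + w)%C - q * w ^ k))%C in T2 by ring.
    rewrite Cmod_opp in T2. lra.
  - intros Hz. exists k. split; [exact Hk|]. intros r alpha Hr Hpol.
    set (q := (C_derive_n p k z0 / RtoC (INR (fact k)))%C) in *.
    assert (Hq : (Cconj (p z0) * q)%C = (RtoC (r / INR (fact k)) * cis alpha)%C).
    { unfold q. rewrite RtoC_div by lra.
      replace (Cconj (p z0) * (C_derive_n p k z0 / RtoC (INR (fact k))))%C
        with ((Cconj (p z0) * C_derive_n p k z0) / RtoC (INR (fact k)))%C by (field; exact Fk').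
      rewrite Hpol. field. exact Fk'. }
    set (M' := 2 * Cmod (p z0) * M + (Cmod q + M) ^ 2).
    assert (HM' : 0 <= M').
    { unfold M'. pose proof (Cmod_ge_0 (p z0)).
      apply Rplus_le_le_0_compat; [apply Rmult_le_pos; lra|apply pow2_ge_0]. }
    assert (Hd' : 0 < Rmin d 1) by (apply Rmin_glb_lt; lra).
    assert (Hrk : 0 < 2 * (r / INR (fact k)))
      by (apply Rmult_lt_0_compat; [lra|apply Rdiv_lt_0_compat; lra]).
    pose proof (fun theta => modulus_leading_term p z0 q k M d _ alpha theta
                  Hk1 HM Hd H Hq) as Lead.
    fold M' in Lead.
    assert (Asc : forall theta, circle_angle theta ->
              0 < cos (alpha + INR k * theta) -> cone_of_ascent p z0 theta).
    { intros theta Hth Hcos. split; [exact Hth|].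
      destruct (eventually_positive _ k _ M' _ (Rmult_lt_0_compat _ _ Hrk Hcos) HM' Hd'
                  (Lead theta)) as [s [s0 Hs]].
      exists s. split; [exact s0|]. intros t Ht. apply Cmod_lt_of_sqr. exact (Hs t Ht). }
    assert (Desc : forall theta, circle_angle theta ->
              cos (alpha + INR k * theta) < 0 -> cone_of_descent p z0 theta).
    { intros theta Hth Hcos. split; [exact Hth|].
      assert (Hneg : 2 * (r / INR (fact k)) * cos (alpha + INR k * theta) < 0) by nra.
      destruct (eventually_negative _ k _ M' _ Hneg HM' Hd' (Lead theta)) as [s [s0 Hs]].
      exists s. split; [exact s0|]. intros t Ht. apply Cmod_lt_of_sqr.
      specialize (Hs t Ht). cbv beta in Hs. lra. }
    split; [|split; [|split; [|split; [|split]]]].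
    + intros theta [[_ [s [s0 Hs]]] [_ [s' [s0' Hs']]]].
      assert (0 < Rmin s s') by (apply Rmin_glb_lt; assumption).
      pose proof (Rmin_l s s'). pose proof (Rmin_r s s').
      specialize (Hs (Rmin s s' / 2) ltac:(lra)).
      specialize (Hs' (Rmin s s' / 2) ltac:(lra)). lra.
    + apply sectors_decompose, Hk1.
    + intros j theta _ Hj Hs. apply Asc; [apply Hs|].
      apply (open_sector_parity k alpha j theta Hk1 Hs), Hj.
    + intros j theta _ Hj Hs. apply Desc; [apply Hs|].
      apply (open_sector_parity k alpha j theta Hk1 Hs), Hj.
    + intros theta Hth [phi [Hphi Hcong]]. apply Asc; [exact Hth|].
      exact (ascent_criterion_cos k alpha theta phi Hk1 Hphi Hcong).
    + intros j theta _ Hb Hl.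
      destruct (ray_trichotomy p z0 theta p_holo (proj1 Hb)) as [L|L];
        [contradiction|exact L].
Qed.
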